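(* Let $C$ be defined by the system $$u^6+v^6+p^6+q^6=2(r^6+s^6),\qquad uv=pq,$$ in the variables $u,v,p,q,r,s$. There are infinitely many elliptic curves over $C$ of rank at least five, parameterized by an elliptic curve of rank at least three over $\mathbb{Q}(p,q,r,s)$, namely by the curve $$E_{p,q,r,s}:\quad y^2=x^3-3(pqrs)^2x+2(pqrs)^3+\tfrac14\left(p^6+s^6-q^6-r^6\right)^2-\left(p^3s^3+q^3r^3\right)^2 .$$
   Context: Here $\mathbb{Q}(p,q,r,s)$ is the rational function field in four independent indeterminates, and the rank of an elliptic curve is the rank of its Mordell--Weil group. When $p,q,r,s$ are taken together with $u,v$ so that $(u,v,p,q,r,s)$ satisfies the system $C$, the curve $E_{p,q,r,s}$ is denoted $E_{u,v,p,q,r,s}$ and is regarded as an elliptic curve over $C$; its rank over $C$ refers to the group of rational maps $C\to E_{u,v,p,q,r,s}$ that commute with the projection $E_{u,v,p,q,r,s}\to C$ (sections). The infinitely many elliptic curves in question are specializations of $E_{u,v,p,q,r,s}$ at rational solutions $(u,v,p,q,r,s)$ of $C$, their rank being the rank over $\mathbb{Q}$. *)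

(* Defs.v *)
From mathcomp Require Import all_boot all_order all_algebra all_field.
From mathcomp Require Export mpoly.
Set Implicit Arguments.
Unset Strict Implicit.
Unset Printing Implicit Defensive.
Import GRing.Theory Num.Theory.
Local Open Scope ring_scope.

(* y^2 = x^3 + a4 x + a6.  The formulas below are the chord-tangent law in
   characteristic different from 2 and 3; every field used here has
   characteristic 0. *)
Record weierstrass (F : fieldType) := Weierstrass { a4 : F; a6 : F }.

Definition disc (F : fieldType) (W : weierstrass F) : F :=
  - 16%:R * (4%:R * a4 W ^+ 3 + 27%:R * a6 W ^+ 2).

Definition elliptic (F : fieldType) (W : weierstrass F) : Prop :=
  disc W != 0.

Inductive point (F : fieldType) := Infinity | Affine of F & F.
Arguments Infinity {F}.

Definition on_curve (F : fieldType) (W : weierstrass F) (P : point F) : Prop :=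
  match P with
  | Infinity => True
  | Affine x y => y ^+ 2 = x ^+ 3 + a4 W * x + a6 W
  end.

Definition ec_opp (F : fieldType) (P : point F) : point F :=
  match P with
  | Infinity => Infinity
  | Affine x y => Affine x (- y)
  end.

Definition ec_line (F : fieldType) (l x1 y1 x2 : F) : point F :=
  let x3 := l ^+ 2 - x1 - x2 in Affine x3 (l * (x1 - x3) - y1).

Definition ec_add (F : fieldType) (W : weierstrass F) (P Q : point F) :
    point F :=
  match P, Q with
  | Infinity, _ => Q
  | _, Infinity => P
  | Affine x1 y1, Affine x2 y2 =>
      if x1 != x2 then ec_line ((y2 - y1) / (x2 - x1)) x1 y1 x2
      else if y1 == - y2 then Infinity
      else ec_line ((3%:R * x1 ^+ 2 + a4 W) / (2%:R * y1)) x1 y1 x2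
  end.

Definition ec_mulz (F : fieldType) (W : weierstrass F) (k : int) (P : point F) :
    point F :=
  match k with
  | Posz n => iter n (ec_add W P) Infinity
  | Negz n => ec_opp (iter n.+1 (ec_add W P) Infinity)
  end.

Definition ec_comb (F : fieldType) (W : weierstrass F) (n : nat)
    (k : 'I_n -> int) (P : 'I_n -> point F) : point F :=
  \big[ec_add W/Infinity]_(i < n) ec_mulz W (k i) (P i).

(* The group W(F) contains n points that are linearly independent over Z. *)
Definition rank_ge (F : fieldType) (W : weierstrass F) (n : nat) : Prop :=
  exists P : 'I_n -> point F,
    (forall i, on_curve W (P i)) /\
    (forall k : 'I_n -> int, ec_comb W k P = Infinity -> forall i, k i = 0).

(* The admissible changes of variables between two short Weierstrass equations
   are x = l^2 x', y = l^3 y'. *)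
Definition ec_isomorphic (F : fieldType) (W W' : weierstrass F) : Prop :=
  exists2 l : F, l != 0 & a4 W = l ^+ 4 * a4 W' /\ a6 W = l ^+ 6 * a6 W'.

Definition E_pqrs (F : fieldType) (p q r s : F) : weierstrass F :=
  Weierstrass
    (- 3%:R * (p * q * r * s) ^+ 2)
    (2%:R * (p * q * r * s) ^+ 3
     + 4%:R^-1 * (p ^+ 6 + s ^+ 6 - q ^+ 6 - r ^+ 6) ^+ 2
     - (p ^+ 3 * s ^+ 3 + q ^+ 3 * r ^+ 3) ^+ 2).

(* A tuple t lists the coordinates u, v, p, q, r, s in this order. *)
Definition on_C (F : fieldType) (t : 6.-tuple F) : Prop :=
  let u := t`_0 in let v := t`_1 in let p := t`_2 in
  let q := t`_3 in let r := t`_4 in let s := t`_5 in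
  u ^+ 6 + v ^+ 6 + p ^+ 6 + q ^+ 6 = 2%:R * (r ^+ 6 + s ^+ 6) /\
  u * v = p * q.

Definition E_uvpqrs (F : fieldType) (t : 6.-tuple F) : weierstrass F :=
  E_pqrs t`_2 t`_3 t`_4 t`_5.

Definition mpeval (h : {mpoly rat[6]}) (t : 6.-tuple algC) : algC :=
  (map_mpoly ratr h).@[tnth t].

(* C is a variety over Q; it is studied through its geometric points C(algC).
   The set of points of C that satisfy U is Zariski dense in C. *)
Definition dense_in_C (U : 6.-tuple algC -> Prop) : Prop :=
  forall h : {mpoly rat[6]},
    (forall t, on_C t -> U t -> mpeval h t = 0) ->
    forall t, on_C t -> mpeval h t = 0.

Definition elliptic_over_C : Prop :=
  dense_in_C (fun t => elliptic (E_uvpqrs t)).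

(* Representatives of rational maps over Q from C to the family E that commute
   with the projection to C: t |-> (X(t) : Y(t) : Z(t)) in the plane that
   contains the fibre E_t, defined where X, Y, Z do not all vanish. *)
Record ratmap := Ratmap {
  rmX : {mpoly rat[6]}; rmY : {mpoly rat[6]}; rmZ : {mpoly rat[6]} }.

Definition defined_at (f : ratmap) (t : 6.-tuple algC) : Prop :=
  [|| mpeval (rmX f) t != 0, mpeval (rmY f) t != 0 | mpeval (rmZ f) t != 0].

Definition is_section (f : ratmap) : Prop :=
  dense_in_C (defined_at f) /\
  forall t, on_C t ->
    let W := E_uvpqrs t in
    let X := mpeval (rmX f) t in
    let Y := mpeval (rmY f) t in
    let Z := mpeval (rmZ f) t in
    Y ^+ 2 * Z = X ^+ 3 + a4 W * X * Z ^+ 2 + a6 W * Z ^+ 3.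

(* On the cubic, Z = 0 forces X = 0, which is the point at infinity. *)
Definition section_at (f : ratmap) (t : 6.-tuple algC) : point algC :=
  let Z := mpeval (rmZ f) t in
  if Z == 0 then Infinity
  else Affine (mpeval (rmX f) t / Z) (mpeval (rmY f) t / Z).

(* The group of sections has fibrewise addition.  Two rational maps are equal
   when they agree on the intersection of the open sets on which they are given;
   a combination of sections is a morphism where all of them are defined and
   the fibre is smooth, so it is the zero section when it vanishes there. *)
Definition section_comb_eq0 (n : nat) (k : 'I_n -> int) (f : 'I_n -> ratmap) :
    Prop :=
  forall t : 6.-tuple algC, on_C t -> elliptic (E_uvpqrs t) ->
    (forall i, defined_at (f i) t) ->
    ec_comb (E_uvpqrs t) k (fun i => section_at (f i) t) = Infinity.

Definition rank_over_C_ge (n : nat) : Prop :=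
  exists f : 'I_n -> ratmap,
    (forall i, is_section (f i)) /\
    (forall k : 'I_n -> int, section_comb_eq0 k f -> forall i, k i = 0).

Definition Qpqrs : fieldType := {fraction {mpoly rat[4]}}.

Definition Qvar (i : 'I_4) : Qpqrs := tofrac ('X_i : {mpoly rat[4]}).

Definition E_generic : weierstrass Qpqrs :=
  E_pqrs (Qvar (inord 0)) (Qvar (inord 1)) (Qvar (inord 2)) (Qvar (inord 3)).

(* Main.v *)
(* Independence is always shown by 2-descent.  If the
   cubic f has no root modulo a prime l0, then E(Q) has no 2-torsion, so points
   are independent as soon as no nontrivial sub-sum of them is divisible by 2.
   A point 2R makes x(2R) - X a square in Q[X]/(f), so at a prime l with a root
   x0 of f mod l, the residue of x(2R) - x0 is a square; finitely many pairs
   (l, x0) decide.  The group law, needed to make sense of "divisible by 2", comes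
   from ideals of the coordinate ring.

   On E_{p,q,r,s} the abscissas p^2s^2 + q^2r^2, p^2q^2 + r^2s^2, p^2r^2 + q^2s^2
   are those of points, and on C so are u^2s^2 + v^2r^2 and u^2r^2 + v^2s^2 by the
   symmetry (p, q) <-> (u, v).
   - The generic rank comes from specialisation at integers congruent to a fixed
     quadruple modulo 31 * 37 * 61; such quadruples are Zariski dense.
   - The rank over C comes from one rational point of C.  There the fifth section
     is a combination of the first four and of an extra point Q of small height,
     which replaces it in the descent.
   - The infinite family lies on the curve Z^2 = W^2 + 16 e^2, V^2 = W^2 + 100 e^2,
     which maps to C and on which Q extends to a section.  Doubling is eventually
     periodic modulo l with period dividing 6 for the primes used, so every sixth
     iterate has the same residues and one computation covers all of them.  Doubling
     also raises the 2-adic valuation of e by one, and this valuation is read off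
     a4^3 / a6^2, so the curves are pairwise non-isomorphic. *)
From HB Require Import structures.
Require Import Defs.
From mathcomp Require Import all_boot all_order all_algebra all_field.
From mathcomp Require Import ring lra zify.
Set Implicit Arguments.
Unset Strict Implicit.
Unset Printing Implicit Defensive.
Import Order.TTheory GRing.Theory Num.Theory.
Local Open Scope ring_scope.

(** * The coordinate ring and the group law *)

(** The pair [(a, b)] stands for a + b Y in F[X][Y] / (Y^2 - f). *)
Definition coord_ring (F : fieldType) (f : {poly F}) : Type :=
  ({poly F} * {poly F})%type.

Section CoordRing.
Variables (F : fieldType) (f : {poly F}).
Local Notation A := (coord_ring f).

HB.instance Definition _ := GRing.Zmodule.on A.

Definition cr_one : A := (1, 0).
Definition cr_mul (g h : A) : A :=
  (g.1 * h.1 + f * (g.2 * h.2), g.1 * h.2 + g.2 * h.1).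

Lemma cr_mulA : associative cr_mul.
Proof. by move=> [a b] [c d] [x y]; congr (_, _) => /=; ring. Qed.
Lemma cr_mulC : commutative cr_mul.
Proof. by move=> [a b] [c d]; congr (_, _) => /=; ring. Qed.
Lemma cr_mul1 : left_id cr_one cr_mul.
Proof. by move=> [a b]; congr (_, _) => /=; ring. Qed.
Lemma cr_mulDl : left_distributive cr_mul +%R.
Proof. by move=> [a b] [c d] [x y]; congr (_, _) => /=; ring. Qed.
Lemma cr_oner_neq0 : cr_one != 0.
Proof. by rewrite xpair_eqE oner_eq0. Qed.

HB.instance Definition _ := GRing.Zmodule_isComNzRing.Build A
  cr_mulA cr_mulC cr_mul1 cr_mulDl cr_oner_neq0.

End CoordRing.

Section LineCoefs.
Variables (F : fieldType) (W : weierstrass F).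

(** These are Vieta's formulas for f(x) - (l x + m)^2 = (x - x1)(x - x2)(x - x3), for chords and
    tangents together. For a chord, [a4] comes from dividing the difference of the two curve
    equations by x2 - x1; for a tangent, from the slope equation. *)
Lemma line_coefs x1 y1 x2 y2 l (m := y1 - l * x1) (x3 := l ^+ 2 - x1 - x2) :
  y1 ^+ 2 = x1 ^+ 3 + a4 W * x1 + a6 W ->
  y2 ^+ 2 = x2 ^+ 3 + a4 W * x2 + a6 W ->
  x1 != x2 /\ y2 - y1 = l * (x2 - x1) \/
  [/\ x1 = x2, y1 = y2, y1 != 0 & 2%:R * y1 * l = 3%:R * x1 ^+ 2 + a4 W] ->
  [/\ y2 = l * x2 + m,
      a4 W = x1 * x2 + x1 * x3 + x2 * x3 + 2%:R * (l * m)
    & a6 W = m ^+ 2 - x1 * x2 * x3].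
Proof.
move=> xy1 xy2 Hl.
have y2m : y2 = l * x2 + m.
  case: Hl => [[_ e]|[e1 e2 _ _]]; last by rewrite /m -e1 e2; ring.
  by rewrite /m -[y2](subrK y1) e; ring.
have a4E : a4 W = x1 * x2 + x1 * x3 + x2 * x3 + 2%:R * (l * m).
  apply/eqP; rewrite -subr_eq0; case: Hl => [[x12 _]|[e1 _ _ e2]].
    have x21 : x2 - x1 != 0 by rewrite subr_eq0 eq_sym.
    apply/eqP/(mulIf x21); rewrite mul0r.
    rewrite -(subrr (y2 ^+ 2 - y1 ^+ 2)) {1}xy2 {1}xy1 y2m /x3 /m; ring.
  rewrite -e1 -(inj_eq (addIr (3%:R * x1 ^+ 2))) addrAC.
  by rewrite (addrC (a4 W)) -e2 /x3 -e1 /m; apply/eqP; ring.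
have a6E : a6 W = m ^+ 2 - x1 * x2 * x3.
  have -> : a6 W = y1 ^+ 2 - x1 ^+ 3 - a4 W * x1 by rewrite xy1; ring.
  by rewrite a4E /x3 /m; ring.
by split.
Qed.

End LineCoefs.

(** * Ideal classes attached to lists of points *)

Section Ideals.
Variables (F : fieldType) (W : weierstrass F) (R : comNzRingType).
Variables (C : {rmorphism F -> R}) (X Y : R).
Hypothesis XY : Y ^+ 2 = X ^+ 3 + C (a4 W) * X + C (a6 W).
Hypothesis two_neq0 : (2%:R : F) != 0.
Hypothesis smooth : elliptic W.
Hypothesis lregX : forall x, GRing.lreg (X - C x).
Hypothesis lregY : forall l m, GRing.lreg (Y - (C l * X + C m)).

(** Membership in the product of the ideals (X - x, Y - y) over the points (x, y) of D. *)
Fixpoint ideal (D : seq (F * F)) (g : R) : Prop :=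
  if D is P :: D' then
    exists al be, [/\ ideal D' al, ideal D' be
                    & g = (X - C P.1) * al + (Y - C P.2) * be]
  else True.

Lemma idealD D g h : ideal D g -> ideal D h -> ideal D (g + h).
Proof.
elim: D g h => //= P D IH g h [a [b [Ia Ib ->]]] [c [d [Ic Id ->]]].
by exists (a + c), (b + d); split; [exact: IH | exact: IH | ring].
Qed.

Lemma idealM D g h : ideal D h -> ideal D (g * h).
Proof.
elim: D h => //= P D IH h [a [b [Ia Ib ->]]].
by exists (g * a), (g * b); split; [exact: IH | exact: IH | ring].
Qed.

Lemma ideal_lin D g h g' h' :
  ideal D h -> ideal D h' -> ideal D (g * h + g' * h').
Proof. by move=> Ih Ih'; apply: idealD; apply: idealM. Qed.

Definition scaled (c : R) (D : seq (F * F)) (g : R) : Prop :=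
  exists2 h, ideal D h & g = c * h.

(** Equality of ideal classes: c I_D = d I_D' with c and d regular, which avoids fractional
    ideals. *)
Definition deq (D D' : seq (F * F)) : Prop :=
  exists c d, [/\ GRing.lreg c, GRing.lreg d
                & forall g, scaled c D g <-> scaled d D' g].

Lemma deq_refl D : deq D D.
Proof. by exists 1, 1; split=> //; apply: lreg1. Qed.

Lemma deq_sym D D' : deq D D' -> deq D' D.
Proof. by move=> [c [d [rc rd H]]]; exists d, c; split=> // g; split=> /H. Qed.

Lemma scaledM c d D g :
  scaled (c * d) D g <-> exists2 h, scaled d D h & g = c * h.
Proof.
split=> [[h Dh ->]|[h [k Dk ->] ->]]; last by exists k; rewrite ?mulrA.
by exists (d * h); rewrite ?mulrA //; exists h.
Qed.

Lemma deq_trans D1 D2 D3 : deq D1 D2 -> deq D2 D3 -> deq D1 D3.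
Proof.
move=> [c [d [rc rd H]]] [c' [d' [rc' rd' H']]].
exists (c' * c), (d * d'); split; [exact: lregM | exact: lregM |] => g.
have eqM a b D D' e : (forall h, scaled a D h <-> scaled b D' h) ->
    scaled (e * a) D g <-> scaled (e * b) D' g.
  by move=> Hab; rewrite !scaledM; split=> -[h /Hab Hh ->]; exists h.
by rewrite (eqM _ _ _ _ c' H) mulrC (eqM _ _ _ _ d H').
Qed.

Lemma deq_cons P D D' : deq D D' -> deq (P :: D) (P :: D').
Proof.
move=> [c [d [rc rd H]]]; exists c, d; split=> // g.
have cons_scaled a b E E' : (forall h, scaled a E h -> scaled b E' h) ->
    scaled a (P :: E) g -> scaled b (P :: E') g.
  move=> Hab [h [al [be [Ial Ibe ->]]] ->].
  have [|h1 I1 e1] := Hab (a * al); first by exists al.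
  have [|h2 I2 e2] := Hab (a * be); first by exists be.
  exists ((X - C P.1) * h1 + (Y - C P.2) * h2); first by exists h1, h2.
  by rewrite !mulrDr ![a * (_ * _)]mulrCA e1 e2 !(mulrCA _ b).
by split; apply: cons_scaled => h /H.
Qed.

Lemma deq_swap P Q D : deq (P :: Q :: D) (Q :: P :: D).
Proof.
exists 1, 1; split; try exact: lreg1.
have swap_scaled P1 P2 g : scaled 1 (P1 :: P2 :: D) g ->
    scaled 1 (P2 :: P1 :: D) g.
  move=> [h [_ [_ [[a1 [a2 [I1 I2 ->]]] [b1 [b2 [J1 J2 ->]]] ->]]] ->].
  eexists; last by [].
  exists ((X - C P1.1) * a1 + (Y - C P1.2) * b1),
         ((X - C P1.1) * a2 + (Y - C P1.2) * b2).
  by split; [exists a1, b1 | exists a2, b2 | ring].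
by split; apply: swap_scaled.
Qed.

Lemma deq_catr D1 D2 E : deq D1 D2 -> deq (E ++ D1) (E ++ D2).
Proof. by move=> H; elim: E => //= P E; apply: deq_cons. Qed.

Lemma deq_catC D E : deq (D ++ E) (E ++ D).
Proof.
elim: D E => [|P D IH] E /=; first by rewrite cats0; apply: deq_refl.
apply: deq_trans (deq_cons P (IH E)) _.
rewrite -cat_rcons; elim: E => [|Q E IHE] /=; first exact: deq_refl.
exact: deq_trans (deq_swap _ _ _) (deq_cons Q IHE).
Qed.

(** The product of the ideals of two opposite points is the principal ideal (X - x). The delicate
    inclusion is that X - x lies in the product. *)
Lemma deq_vertical x y D : y ^+ 2 = x ^+ 3 + a4 W * x + a6 W ->
  deq ((x, y) :: (x, - y) :: D) D.
Proof.
move=> xy.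
have Cxy : C y ^+ 2 = C x ^+ 3 + C (a4 W) * C x + C (a6 W).
  by rewrite -!(rmorphXn, rmorphM, rmorphD) /= xy.
pose q := X ^+ 2 + X * C x + C x ^+ 2 + C (a4 W).
exists 1, (X - C x); split; [exact: lreg1 | exact: lregX |] => g; split.
  move=> [h [_ [_ [[a1 [a2 [I1 I2 ->]]] [b1 [b2 [J1 J2 ->]]] /= ->]]] ->].
  exists ((X - C x) * a1 + (Y + C y) * a2 + ((Y - C y) * b1 + q * b2)).
    by apply: idealD; apply: ideal_lin.
  by rewrite rmorphN /q; ring: XY Cxy.
move=> [h Ih ->]; eexists; last by rewrite mul1r.
have [y0|y0] := eqVneq y 0.
  (* If f'(x) vanished too, x would be a double root and the discriminant would be 0. *)
  have fx0 : 3%:R * x ^+ 2 + a4 W != 0.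
    apply/eqP => fx0; move/eqP: smooth; apply; rewrite /disc.
    have := xy; rewrite y0 expr0n /= => {}xy.
    have a4E : a4 W = - 3%:R * x ^+ 2.
      by rewrite -[LHS]subr0 -fx0; ring.
    have a6E : a6 W = 2%:R * x ^+ 3.
      by rewrite -[LHS]subr0 [X in _ - X]xy a4E; ring.
    by rewrite a6E a4E; ring.
  set z := 3%:R * x ^+ 2 + a4 W in fx0.
  have zE : C (a4 W) * C z^-1 = 1 - 3%:R * C x ^+ 2 * C z^-1.
    apply/eqP; rewrite eq_sym subr_eq addrC -mulrDl eq_sym; apply/eqP.
    rewrite -[RHS](rmorph1 C) -[in RHS](divff fx0) rmorphM; congr (_ * _).
    by rewrite /z rmorphD rmorphM rmorphXn rmorph_nat.
  (* With z = f'(x) and y = 0, the witnesses express z (X - x) = Y^2 - (X - x)^2 (X + 2 x). *)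
  exists ((X - C x) * (- C z^-1 * (X + 2%:R * C x) * h) + (Y + C y) * 0),
         ((X - C x) * 0 + (Y + C y) * (C z^-1 * h)).
  split; [exists (- C z^-1 * (X + 2%:R * C x) * h), 0
         | exists 0, (C z^-1 * h)|].
  - by rewrite rmorphN opprK; split; [exact: idealM | rewrite -(mul0r h); exact: idealM |].
  - by rewrite rmorphN opprK; split; [rewrite -(mul0r h); exact: idealM | exact: idealM |].
  have a6E : C (a6 W) = C y ^+ 2 - C x ^+ 3 - C (a4 W) * C x.
    by rewrite Cxy; ring.
  by rewrite /= y0 rmorph0 in a6E *; ring: zE a6E XY.
pose z := 2%:R * y.
have z0 : z != 0 by rewrite mulf_neq0.
have zE : C z^-1 * C y * 2%:R = 1.
  rewrite -[RHS](rmorph1 C) -(divff z0) rmorphM [in RHS]/z rmorphM rmorph_nat.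
  by ring.
(* Here the identity is 2 y (X - x) = (X - x)(Y + y) - (Y - y)(X - x). *)
exists ((X - C x) * 0 + (Y + C y) * (C z^-1 * h)),
       ((X - C x) * (- C z^-1 * h) + (Y + C y) * 0).
split; [exists 0, (C z^-1 * h) | exists (- C z^-1 * h), 0 |].
- by rewrite rmorphN opprK; split; [rewrite -(mul0r h); exact: idealM | exact: idealM |].
- by rewrite rmorphN opprK; split; [exact: idealM | rewrite -(mul0r h); exact: idealM |].
by rewrite -[h in LHS]mul1r -zE /=; ring.
Qed.

(* With L = Y - (l X + m) the line through P and Q, and x3 the abscissa of the
   third intersection point, the ideal of P and Q is (L, (X - x1)(X - x2)), and
   L (Y + l X + m) = (X - x1) (X - x2) (X - x3). *)
Lemma deq_line x1 y1 x2 y2 l D :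
  y1 ^+ 2 = x1 ^+ 3 + a4 W * x1 + a6 W ->
  y2 ^+ 2 = x2 ^+ 3 + a4 W * x2 + a6 W ->
  x1 != x2 /\ y2 - y1 = l * (x2 - x1) \/
  [/\ x1 = x2, y1 = y2, y1 != 0 & 2%:R * y1 * l = 3%:R * x1 ^+ 2 + a4 W] ->
  let x3 := l ^+ 2 - x1 - x2 in
  deq ((x1, y1) :: (x2, y2) :: D) ((x3, l * (x1 - x3) - y1) :: D).
Proof.
move=> xy1 xy2 Hl x3; set y3 := l * (x1 - x3) - y1.
pose m := y1 - l * x1; pose L := Y - (C l * X + C m).
have [y2m a4E a6E] := line_coefs xy1 xy2 Hl.
rewrite -/m -/x3 in y2m a4E a6E.
have cubic : L * (Y + (C l * X + C m)) = (X - C x1) * (X - C x2) * (X - C x3).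
  have -> : L * (Y + (C l * X + C m)) = Y ^+ 2 - (C l * X + C m) ^+ 2.
    by rewrite /L; ring.
  by rewrite XY a4E a6E /x3; ring.
have y1E : Y - C y1 = L + C l * (X - C x1).
  by rewrite /L /m; ring.
have y2E : Y - C y2 = L + C l * (X - C x2).
  by rewrite /L y2m /m; ring.
have y3E : Y - C y3 = Y + (C l * X + C m) - C l * (X - C x3).
  by rewrite /y3 /m; ring.
have idE a1 a2 b1 b2 : ideal D a1 -> ideal D a2 -> ideal D b1 -> ideal D b2 ->
    ideal ((x1, y1) :: (x2, y2) :: D)
      ((X - C x1) * ((X - C x2) * a1 + (Y - C y2) * a2)
       + (Y - C y1) * ((X - C x2) * b1 + (Y - C y2) * b2)).
  move=> Ia1 Ia2 Ib1 Ib2; do 2 eexists; split; last by [].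
    by exists a1, a2.
  by exists b1, b2.
have id0 h : ideal D h -> ideal D 0 by move=> Ih; rewrite -(mul0r h); apply: idealM.
have idL h : ideal D h -> ideal ((x1, y1) :: (x2, y2) :: D) (L * h).
  move=> Ih; case: Hl => [[x12 _]|[e1 e2 y0 _]].
    have x21 : x2 - x1 != 0 by rewrite subr_eq0 eq_sym.
    have iE : C (x2 - x1)^-1 * (C x2 - C x1) = 1.
      by rewrite -(rmorphB C) -rmorphM mulVf // rmorph1.
    (* Chord case: (x2 - x1) L = (X - x1)(Y - y2) - (Y - y1)(X - x2). *)
    have -> : L * h = (X - C x1) * ((X - C x2) * 0 + (Y - C y2) * (C (x2 - x1)^-1 * h))
       + (Y - C y1) * ((X - C x2) * (- C (x2 - x1)^-1 * h) + (Y - C y2) * 0).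
      by rewrite -[L]mul1r -iE y1E y2E; ring.
    by apply: idE; (exact: idealM || exact: id0 Ih).
  have z0 : 2%:R * y1 != 0 by rewrite mulf_neq0.
  have iE : C (2%:R * y1)^-1 * (2%:R * C y1) = 1.
    by rewrite -(rmorph_nat C 2) -!rmorphM mulVf // rmorph1.
  set i := C _^-1 in iE.
  (* Tangent case: squaring Y - y1 = L + l (X - x1) and subtracting from the cubic relation leaves 2
     y1 L, and 2 y1 is invertible. *)
  have LE : 2%:R * C y1 * L = (X - C x1) ^+ 2 * (X - C x3 + C l ^+ 2) - (Y - C y1) ^+ 2.
    have -> : (X - C x1) ^+ 2 * (X - C x3 + C l ^+ 2) =
              (X - C x1) * (X - C x2) * (X - C x3) + C l ^+ 2 * (X - C x1) ^+ 2.
      by rewrite e1; ring.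
    by rewrite -cubic /L /m; ring.
  have -> : L * h = (X - C x1) * ((X - C x2) * (i * (X - C x3 + C l ^+ 2) * h) + (Y - C y2) * 0)
     + (Y - C y1) * ((X - C x2) * 0 + (Y - C y2) * (- i * h)).
    have -> : L * h = i * (2%:R * C y1 * L) * h by rewrite !mulrA -(mulrA i) iE mul1r.
    by rewrite LE -e1 -e2; ring.
  by apply: idE; (exact: idealM || exact: id0 Ih).
exists (X - C x3), L; split; [exact: lregX | exact: lregY |] => g; split.
  move=> [h [_ [_ [[a1 [a2 [I1 I2 ->]]] [b1 [b2 [J1 J2 ->]]] /= ->]]] ->].
  (* Substituting Y - y1 = L + l (X - x1) and Y - y2 = L + l (X - x2) rewrites the element as (X -
     x1)(X - x2) A + L B. *)
  pose A := a1 + C l * (a2 + b1) + C l ^+ 2 * b2.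
  pose B := (X - C x1) * a2 + (X - C x2) * b1
            + (L + C l * (X - C x1) + C l * (X - C x2)) * b2.
  have IA : ideal D A.
    by apply: idealD; [apply: idealD => // |]; apply: idealM => //; apply: idealD.
  have IB : ideal D B.
    by apply: idealD; [apply: idealD |]; apply: idealM.
  exists ((X - C x3) * (B + C l * A) + (Y - C y3) * A).
    by exists (B + C l * A), A; split=> //; apply: idealD => //; apply: idealM.
  rewrite y1E y2E y3E.
  have -> : L * ((X - C x3) * (B + C l * A) +
                 (Y + (C l * X + C m) - C l * (X - C x3)) * A) =
            L * (X - C x3) * B + L * (Y + (C l * X + C m)) * A by ring.
  by rewrite cubic /A /B; ring.
move=> [_ [a [b [Ia Ib /= ->]] ->]].
exists (L * (a - C l * b) + (X - C x1) * (X - C x2) * b).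
  apply: idealD; first by apply: idL; apply: idealD => //; rewrite -mulNr; apply: idealM.
  have -> : (X - C x1) * (X - C x2) * b =
      (X - C x1) * ((X - C x2) * b + (Y - C y2) * 0)
      + (Y - C y1) * ((X - C x2) * 0 + (Y - C y2) * 0) by ring.
  by apply: idE => //; exact: id0 Ia.
have -> : (X - C x3) * (L * (a - C l * b) + (X - C x1) * (X - C x2) * b) =
  (X - C x3) * L * (a - C l * b) + (X - C x1) * (X - C x2) * (X - C x3) * b by ring.
by rewrite -cubic y3E; ring.
Qed.

Definition cls (P : point F) : seq (F * F) :=
  if P is Affine x y then [:: (x, y)] else [::].

(** Infinity has the unit ideal, so addition of points becomes multiplication of ideal classes:
    opposite points cancel by [deq_vertical], and all other pairs are chords or tangents. *)
Lemma deq_add P Q D : on_curve W P -> on_curve W Q ->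
  deq (cls P ++ cls Q ++ D) (cls (ec_add W P Q) ++ D).
Proof.
case: P Q => [|x1 y1] [|x2 y2] //= H1 H2; try exact: deq_refl.
case: eqVneq => [e1|x12] /=; last first.
  apply: deq_line => //; left; split=> //.
  by rewrite divfK // subr_eq0 eq_sym.
subst x2; case: eqVneq => [e2|y12] /=.
  by have -> : y2 = - y1 by [rewrite e2 opprK]; apply: deq_vertical.
have e : y2 = y1.
  have : (y2 - y1) * (y2 + y1) = 0 by rewrite -subr_sqr H1 H2 subrr.
  move/eqP; rewrite mulf_eq0 subr_eq0 addr_eq0 => /orP [/eqP //|/eqP ey].
  by rewrite ey opprK eqxx in y12.
subst y2.
have y0 : y1 != 0 by apply: contra_neq y12 => ->; rewrite oppr0.
by apply: deq_line => //; right; split=> //; rewrite mulrC divfK // mulf_neq0.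
Qed.

End Ideals.

(** * The coordinate ring F[X, Y] / (Y^2 - f) and associativity *)

Section ConcreteRing.
Variables (F : fieldType) (W : weierstrass F).
Hypothesis two_neq0 : (2%:R : F) != 0.
Hypothesis smooth : elliptic W.

Definition cubic_poly : {poly F} := 'X^3 + (a4 W)%:P * 'X + (a6 W)%:P.
Local Notation f := cubic_poly.
Local Notation A := (coord_ring f).

Lemma size_cubic : size f = 4.
Proof.
rewrite /cubic_poly -addrA size_polyDl ?size_polyXn //.
rewrite (leq_ltn_trans (size_polyD _ _)) // gtn_max.
rewrite (leq_ltn_trans (size_polyC_leq1 _)) // andbT.
rewrite (leq_ltn_trans (size_polyMleq _ _)) // size_polyX addn2 /= ltnS.
exact: leq_trans (size_polyC_leq1 _) _.
Qed.

Definition cr_const (c : F) : A := (c%:P, 0).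
Lemma cr_const_additive : zmod_morphism cr_const.
Proof. by move=> a b; congr (_, _); rewrite ?subr0 //= polyCB. Qed.
Lemma cr_const_multiplicative : monoid_morphism cr_const.
Proof.
by split=> // a b; congr (_, _); rewrite /= ?mulr0 ?mul0r ?addr0 // polyCM.
Qed.
HB.instance Definition _ :=
  GRing.isZmodMorphism.Build F A cr_const cr_const_additive.
HB.instance Definition _ :=
  GRing.isMonoidMorphism.Build F A cr_const cr_const_multiplicative.

Definition cr_X : A := ('X, 0).
Definition cr_Y : A := (0, 1).

Lemma cr_XY : cr_Y ^+ 2 = cr_X ^+ 3 + cr_const (a4 W) * cr_X + cr_const (a6 W).
Proof.
rewrite !exprS !expr0 !mulr1; congr (_, _) => /=; last by ring.
by rewrite /cubic_poly; ring.
Qed.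

(** The product of a + b Y with its conjugate a - b Y. *)
Definition cr_norm (g : A) : {poly F} := g.1 ^+ 2 - f * g.2 ^+ 2.

Lemma cr_normM g h : cr_norm (g * h) = cr_norm g * cr_norm h.
Proof. by case: g h => [a b] [c d]; rewrite /cr_norm /=; ring. Qed.

Lemma size_sqr (p : {poly F}) : size (p ^+ 2) = (size p).*2.-1.
Proof.
have [->|p0] := eqVneq p 0; first by rewrite expr0n /= size_poly0.
by rewrite expr2 size_mul // addnn.
Qed.

(** The degree of a^2 is even and that of f b^2 is odd, so the leading terms cannot cancel. *)
Lemma size_cr_norm (g : A) : g != 0 ->
  size (cr_norm g) = if g.2 == 0 then (size g.1).*2.-1
                     else maxn (size g.1).*2.-1 (size g.2).*2.+2.
Proof.
case: g => [a b] /=; rewrite /cr_norm /=.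
have [->|b0] := eqVneq b 0; first by rewrite expr0n /= mulr0 subr0 size_sqr.
move=> _; have sb : size (f * b ^+ 2) = (size b).*2.+2.
  rewrite size_mul ?expf_neq0 // -?size_poly_eq0 size_cubic // size_sqr.
  by case: (size b) (size_poly_eq0 b) => [|n _]; rewrite ?(negPf b0).
have neq : size (a ^+ 2) != size (f * b ^+ 2).
  rewrite sb size_sqr; case: (size a) => [|n] //.
  by apply/eqP => /(congr1 odd); rewrite doubleS /= !odd_double.
rewrite -sb -size_sqr; case: ltngtP neq => // lt_ab _.
  by rewrite addrC size_polyDl size_polyN.
by rewrite size_polyDl // size_polyN.
Qed.

Lemma cr_eq0 (g : A) : (g == 0) = (g.1 == 0) && (g.2 == 0).
Proof. by case: g. Qed.

Lemma cr_norm_eq0 (g : A) : (cr_norm g == 0) = (g == 0).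
Proof.
apply/idP/idP => [|/eqP ->]; last by rewrite /cr_norm expr0n /= mulr0 subr0.
apply: contraTT => g0; rewrite -size_poly_eq0 size_cr_norm //.
move: g0; rewrite cr_eq0; case: g => [a b] /=; have [b0|b0] := eqVneq b 0.
  by rewrite andbT -size_poly_eq0; case: (size a).
by rewrite -lt0n leq_max orbT.
Qed.

Lemma cr_lreg (g : A) : g != 0 -> GRing.lreg g.
Proof.
move=> g0 h k e.
have : cr_norm (g * (h - k)) = 0 by rewrite mulrBr e subrr; apply/eqP; rewrite cr_norm_eq0.
rewrite cr_normM => /eqP; rewrite mulf_eq0 !cr_norm_eq0 (negPf g0) /=.
by rewrite subr_eq0 => /eqP.
Qed.

Lemma cr_lregX x : GRing.lreg (cr_X - cr_const x).
Proof. by apply: cr_lreg; rewrite cr_eq0 /= polyXsubC_eq0. Qed.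

Lemma cr_lregY l m : GRing.lreg (cr_Y - (cr_const l * cr_X + cr_const m)).
Proof.
apply: cr_lreg; rewrite cr_eq0 negb_and orbC.
have -> : (cr_Y - (cr_const l * cr_X + cr_const m)).2 = 1 by rewrite /=; ring.
by rewrite oner_eq0.
Qed.

Local Notation deq := (deq cr_const cr_X cr_Y).
Local Notation ideal := (ideal cr_const cr_X cr_Y).

(* A generator of the ideal of a point would have a norm of degree 1 or 2,
   dividing the norms (X - x)^2 and y^2 - f of X - x and Y - y. *)
Lemma deq1_nil x y : y ^+ 2 = x ^+ 3 + a4 W * x + a6 W -> ~ deq [:: (x, y)] [::].
Proof.
move=> xy [c [d [rc rd H]]].
(* The element w = d / c would generate the ideal of the point. *)
have [w Iw dE] : scaled cr_const cr_X cr_Y c [:: (x, y)] d.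
  by apply/H; exists 1; rewrite ?mulr1.
have wgen u : ideal [:: (x, y)] u -> exists h, u = w * h.
  move=> Iu; have /H [h _ e] : scaled cr_const cr_X cr_Y c [:: (x, y)] (c * u).
    by exists u.
  by exists h; apply: rc; rewrite e dE mulrA.
have [h hE] : exists h, cr_X - cr_const x = w * h.
  by apply: wgen; exists 1, 0; split=> //=; rewrite mulr1 mulr0 addr0.
have [k kE] : exists h, cr_Y - cr_const y = w * h.
  by apply: wgen; exists 0, 1; split=> //=; rewrite mulr1 mulr0 add0r.
have /= Nh : ('X - x%:P) ^+ 2 = cr_norm w * cr_norm h.
  by rewrite -cr_normM -hE /cr_norm /= subr0 expr0n /= mulr0 subr0.
have /= Nk : y%:P ^+ 2 - f = cr_norm w * cr_norm k.
  by rewrite -cr_normM -kE /cr_norm /=; ring.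
have w0 : w != 0.
  apply: contraTneq isT => w0; move/eqP: hE; rewrite w0 mul0r cr_eq0 /=.
  by rewrite polyXsubC_eq0.
have Nk0 : y%:P ^+ 2 - f != 0.
  rewrite subr_eq0 -polyC_exp; apply/eqP => /(congr1 (fun p : {poly F} => size p)).
  by rewrite size_cubic; have := size_polyC_leq1 (y ^+ 2); case: size => // -[].
have size_Nk : size (y%:P ^+ 2 - f) = 4.
  rewrite addrC size_polyDl size_polyN size_cubic // -polyC_exp.
  exact: leq_ltn_trans (size_polyC_leq1 _) _.
have k0 : k != 0 by apply: contra_neq Nk0 => k0; rewrite Nk k0 /cr_norm expr0n /= mulr0 subr0 mulr0.
have h0 : h != 0.
  apply: contraTneq isT => h0; move/eqP: hE; rewrite h0 mulr0 cr_eq0 /=.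
  by rewrite polyXsubC_eq0.
have := congr1 (fun p : {poly F} => size p) Nh.
rewrite size_sqr (size_XsubC x : _ = 2%N) size_mul ?cr_norm_eq0 // => size_Nh.
have := congr1 (fun p : {poly F} => size p) Nk.
rewrite size_Nk size_mul ?cr_norm_eq0 // => size_Nk'.
have Npos (g : A) : g != 0 -> (0 < size (cr_norm g))%N.
  by rewrite size_poly_gt0 cr_norm_eq0.
have Nspec (g : A) : g != 0 -> (g.2 = 0 /\ exists n, size g.1 = n.+1 /\
    size (cr_norm g) = n.*2.+1) \/ (4 <= size (cr_norm g))%N.
  move=> g0; rewrite size_cr_norm //; have [b0|b0] := eqVneq g.2 0.
    left; split=> //; move: g0; rewrite cr_eq0 b0 eqxx andbT -size_poly_eq0.
    by case: (size g.1) => // n _; exists n.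
  right; rewrite leq_max; apply/orP; right.
  by rewrite -size_poly_eq0 in b0; case: (size g.2) b0.
(* A norm has even degree when the Y-part is 0, and degree at least 3 otherwise. The norms of w and
   h have degrees of sum 2, so both are of the first kind; those of w and k have sum 3, so k is of
   the second kind and w has a norm of degree 0. *)
have {h hE Nh h0 size_Nh size_Nk size_Nk' k kE Nk k0 Nk0} [a aE] : exists a : F, w = cr_const a.
  case: (Nspec _ h0) => [[_ [nh [_ Eh]]]|Eh]; last first.
    exfalso; move: (Npos w w0) Eh size_Nh.
    by move: (size (cr_norm w)) (size (cr_norm h)) => i j; lia.
  case: (Nspec _ w0) => [[w2 [nw [sw Ew]]]|Ew]; last first.
    exfalso; move: (Npos h h0) Ew size_Nh.
    by move: (size (cr_norm w)) (size (cr_norm h)) => i j; lia.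
  case: (Nspec _ k0) => [[k2 [nk [sk Ek]]]|Ek]; first by
    exfalso; move: size_Nk'; rewrite Ew Ek; lia.
  have nw0 : nw = 0%N.
    move: size_Nh (Npos h h0); rewrite Ew; move: (size (cr_norm h)) Ek size_Nk'.
    by rewrite Ew; move: (size (cr_norm k)) => i j; lia.
  have /size_poly1P [a a0 wa] : size w.1 == 1 by rewrite sw nw0.
  by exists a; move: wa w2; case: (w) => /= ? ? -> ->.
move: Iw; rewrite aE => -[al [be [_ _ [e1 e2]]]].
(* Elements of the ideal vanish at (x, y): the Y-part gives [be.1] = y [be.2] at x, and the other
   part then gives a = 0. *)
have a0 : a = 0.
  have be1 : be.1 = y%:P * be.2 - ('X - x%:P) * al.2.
    by apply/eqP; rewrite -subr_eq0 [X in _ == X]e2 /=; apply/eqP; ring.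
  have := congr1 (fun p => p.[x]) e1; rewrite /= be1 /cubic_poly !hornerE /= => ->.
  by rewrite subrr; ring: xy.
by move: w0; rewrite aE a0 rmorph0 eqxx.
Qed.

Lemma on_curve_add P Q :
  on_curve W P -> on_curve W Q -> on_curve W (ec_add W P Q).
Proof.
case: P Q => [|x1 y1] [|x2 y2] //= xy1 xy2.
have line l : x1 != x2 /\ y2 - y1 = l * (x2 - x1) \/
    [/\ x1 = x2, y1 = y2, y1 != 0 & 2%:R * y1 * l = 3%:R * x1 ^+ 2 + a4 W] ->
    on_curve W (ec_line l x1 y1 x2).
  by move=> /(line_coefs xy1 xy2) [_ e4 e6]; rewrite /= e4 e6; ring.
case: eqVneq => [e1|x12] /=; last first.
  by apply: line; left; split=> //; rewrite divfK // subr_eq0 eq_sym.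
case: eqVneq => [//|y12] /=; apply: line; right.
have e : y2 = y1.
  have : (y2 - y1) * (y2 + y1) = 0 by rewrite -subr_sqr xy1 xy2 e1 subrr.
  move/eqP; rewrite mulf_eq0 subr_eq0 addr_eq0 => /orP [/eqP //|/eqP ey].
  by rewrite ey opprK eqxx in y12.
have y0 : y1 != 0 by apply: contra_neq y12 => y0; rewrite e y0 oppr0.
by split=> //; rewrite mulrC divfK // mulf_neq0.
Qed.

Lemma on_curve_opp P : on_curve W P -> on_curve W (ec_opp P).
Proof. by case: P => //= x y <-; rewrite sqrrN. Qed.

Local Notation cls := (@cls F).

Lemma deq_ec_add P Q D : on_curve W P -> on_curve W Q ->
  deq (cls P ++ cls Q ++ D) (cls (ec_add W P Q) ++ D).
Proof. by apply: deq_add => //; [exact: cr_XY | exact: cr_lregX | exact: cr_lregY]. Qed.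

(** If the classes agree, P - Q has the trivial class, so it is Infinity by [deq1_nil]. *)
Lemma cls_inj P Q : on_curve W P -> on_curve W Q -> deq (cls P) (cls Q) -> P = Q.
Proof.
move=> HP HQ PQ; have HQ' := on_curve_opp HQ.
have d1 : deq (cls (ec_opp Q) ++ cls P) (cls (ec_opp Q) ++ cls Q) by apply: deq_catr.
have Q0 : ec_add W Q (ec_opp Q) = Infinity.
  by case: (Q) => //= x y; rewrite !eqxx opprK eqxx.
have d2 : deq (cls (ec_opp Q) ++ cls Q) [::].
  apply: deq_trans (deq_catC _ _ _ _ _) _.
  by have := deq_ec_add [::] HQ HQ'; rewrite Q0 !cats0.
have d3 : deq (cls (ec_add W P (ec_opp Q))) [::].
  apply: deq_trans (deq_trans d1 d2).
  apply: deq_trans (deq_catC _ _ _ _ _); apply: deq_sym.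
  by have := deq_ec_add [::] HP HQ'; rewrite !cats0.
have := on_curve_add HP HQ'; case E : (ec_add W P (ec_opp Q)) d3 => [|x y].
  move=> _ _; case: P Q E {HP HQ PQ HQ' d1 d2 Q0} => [|x1 y1] [|x2 y2] //=.
  case: eqVneq => [->|//] /=; rewrite opprK; case: eqVneq => [->|//] //.
by move=> d3 /deq1_nil.
Qed.

(** Both sides have the class of the product of the three ideals, and a point is determined by its
    class. *)
Lemma ec_addA P Q S : on_curve W P -> on_curve W Q -> on_curve W S ->
  ec_add W P (ec_add W Q S) = ec_add W (ec_add W P Q) S.
Proof.
move=> HP HQ HS; have HQS := on_curve_add HQ HS; have HPQ := on_curve_add HP HQ.
have d1 : deq (cls P ++ cls (ec_add W Q S)) (cls (ec_add W P (ec_add W Q S))).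
  by have := deq_ec_add [::] HP HQS; rewrite !cats0.
have d2 : deq (cls (ec_add W P Q) ++ cls S) (cls (ec_add W (ec_add W P Q) S)).
  by have := deq_ec_add [::] HPQ HS; rewrite !cats0.
apply: cls_inj; [exact: on_curve_add | exact: on_curve_add |].
apply: (deq_trans (deq_sym d1)); apply: deq_trans d2.
apply: deq_trans (deq_ec_add _ HP HQ); apply: deq_catr.
by have := deq_ec_add [::] HQ HS; rewrite !cats0 => /deq_sym.
Qed.

Lemma ec_addC P Q : on_curve W P -> on_curve W Q -> ec_add W P Q = ec_add W Q P.
Proof.
move=> HP HQ; apply: cls_inj; do ?exact: on_curve_add.
have := deq_ec_add [::] HP HQ; have := deq_ec_add [::] HQ HP; rewrite !cats0.
by move=> d1 d2; apply: deq_trans (deq_sym d2) (deq_trans (deq_catC _ _ _ _ _) d1).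
Qed.

Lemma ec_addNP P : ec_add W (ec_opp P) P = Infinity.
Proof. by case: P => //= x y; rewrite !eqxx. Qed.

End ConcreteRing.

(** * The abelian group of points *)

Definition point_opt (F : fieldType) (P : point F) : option (F * F) :=
  if P is Affine x y then Some (x, y) else None.
Definition opt_point (F : fieldType) (o : option (F * F)) : point F :=
  if o is Some (x, y) then Affine x y else Infinity.
Lemma point_optK (F : fieldType) : cancel (@point_opt F) (@opt_point F).
Proof. by case. Qed.

HB.instance Definition _ (F : fieldType) :=
  Choice.copy (point F) (can_type (@point_optK F)).

Definition on_curveb (F : fieldType) (W : weierstrass F) (P : point F) : bool :=
  if P is Affine x y then y ^+ 2 == x ^+ 3 + a4 W * x + a6 W else true.

Lemma on_curveP (F : fieldType) (W : weierstrass F) P :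
  reflect (on_curve W P) (on_curveb W P).
Proof. by case: P => [|x y]; [left | exact: eqP]. Qed.

(** The two hypotheses are arguments of the type so that the group structure declared on it can rely
    on them. *)
Definition ec_group (F : fieldType) (W : weierstrass F)
    (two_neq0 : (2%:R : F) != 0) (smooth : elliptic W) : Type :=
  {P : point F | on_curveb W P}.

Section Group.
Variables (F : fieldType) (W : weierstrass F).
Variables (two_neq0 : (2%:R : F) != 0) (smooth : elliptic W).
Local Notation G := (ec_group two_neq0 smooth).

HB.instance Definition _ := Choice.on G.
HB.instance Definition _ := [isSub of G for @sval _ _].

Lemma ec_groupP (P : G) : on_curve W (val P).
Proof. by apply/on_curveP; case: P. Qed.

Definition ecg_zero : G := exist _ Infinity isT.
Definition ecg_opp (P : G) : G :=
  exist _ (ec_opp (val P)) (introT (on_curveP W _) (on_curve_opp (ec_groupP P))).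
Definition ecg_add (P Q : G) : G :=
  exist _ (ec_add W (val P) (val Q))
    (introT (on_curveP W _) (on_curve_add two_neq0 (ec_groupP P) (ec_groupP Q))).

Lemma ecg_addA : associative ecg_add.
Proof.
by move=> P Q S; apply: val_inj; apply: ec_addA => //; exact: ec_groupP.
Qed.
Lemma ecg_addC : commutative ecg_add.
Proof. by move=> P Q; apply: val_inj; apply: ec_addC => //; exact: ec_groupP. Qed.
Lemma ecg_add0 : left_id ecg_zero ecg_add.
Proof. by move=> P; apply: val_inj. Qed.
Lemma ecg_addN : left_inverse ecg_zero ecg_opp ecg_add.
Proof. by move=> P; apply: val_inj; apply: ec_addNP. Qed.

HB.instance Definition _ :=
  GRing.isZmodule.Build G ecg_addA ecg_addC ecg_add0 ecg_addN.

Lemma val_ecg_add (P Q : G) : val (P + Q) = ec_add W (val P) (val Q).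
Proof. by []. Qed.

Lemma val_ecg_mulrz (P : G) (k : int) : val (P *~ k) = ec_mulz W k (val P).
Proof.
have muln n : val (P *+ n) = iter n (ec_add W (val P)) Infinity.
  by elim: n => //= n <-; rewrite mulrS.
by case: k => n; rewrite /ec_mulz -muln.
Qed.

Lemma val_ecg_comb n (k : 'I_n -> int) (P : 'I_n -> G) :
  val (\sum_(i < n) P i *~ k i) = ec_comb W k (fun i => val (P i)).
Proof.
rewrite /ec_comb (big_morph val (id1 := Infinity) (op1 := ec_add W)) //.
by apply: eq_bigr => i _; rewrite val_ecg_mulrz.
Qed.

Lemma ecg_mk P : on_curve W P -> {Q : G | val Q = P}.
Proof. by move=> /on_curveP HP; exists (exist _ P HP). Qed.

End Group.

(** * Complete 2-descent *)

Section Descent.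
Variables (F : fieldType) (W : weierstrass F).
Variables (two_neq0 : (2%:R : F) != 0) (smooth : elliptic W).
Hypothesis no_root : forall x, x ^+ 3 + a4 W * x + a6 W != 0.
Local Notation G := (ec_group two_neq0 smooth).
Local Notation f := (cubic_poly W).

Definition square_mod (p : {poly F}) : Prop :=
  exists g h, p = g ^+ 2 + f * h.

Definition delta (P : point F) : {poly F} :=
  if P is Affine x _ then x%:P - 'X else 1.

Lemma square_modM p q : square_mod p -> square_mod q -> square_mod (p * q).
Proof.
move=> [g [h ->]] [g' [h' ->]].
by exists (g * g'), (g ^+ 2 * h' + g' ^+ 2 * h + f * h * h'); ring.
Qed.

(** The inverse comes from f(x) = f(X) + (x - X) q, where f(x) is a nonzero constant. *)
Lemma delta_unit P : exists d e, delta P * d = 1 + f * e.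
Proof.
case: P => [|x y] /=; first by exists 1, 0; rewrite mulr0 addr0 mulr1.
have := no_root x; set z := _ + a6 W => z0.
pose q : {poly F} := 'X^2 + x%:P * 'X + x%:P ^+ 2 + (a4 W)%:P.
exists (z^-1%:P * q), (- z^-1%:P).
have <- : z%:P * z^-1%:P = 1 :> {poly F} by rewrite -polyCM divff.
have -> : z%:P = x%:P ^+ 3 + (a4 W)%:P * x%:P + (a6 W)%:P.
  by rewrite /z; ring.
by rewrite /q /cubic_poly; ring.
Qed.

Lemma square_mod_cancel P p : square_mod (p * delta P ^+ 2) -> square_mod p.
Proof.
have [d [e de]] := delta_unit P => -[g [h gh]].
exists (g * d), (h * d ^+ 2 - (2%:R * e + f * e ^+ 2) * p).
have -> : (g * d) ^+ 2 + f * (h * d ^+ 2 - (2%:R * e + f * e ^+ 2) * p) =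
  (g ^+ 2 + f * h) * d ^+ 2 - ((1 + f * e) ^+ 2 - 1) * p by ring.
by rewrite -gh -de; ring.
Qed.

(* If the line y = l x + m meets the curve at abscissas x1, x2, x3, then
   (x1 - X)(x2 - X)(x3 - X) = (l X + m)^2 - f. *)
Lemma delta_add P Q : on_curve W P -> on_curve W Q ->
  square_mod (delta P * delta Q * delta (ec_add W P Q)).
Proof.
case: P Q => [|x1 y1] [|x2 y2] //= xy1 xy2.
- by exists 1, 0; ring.
- by exists (x2%:P - 'X), 0; ring.
- by exists (x1%:P - 'X), 0; ring.
have line l : x1 != x2 /\ y2 - y1 = l * (x2 - x1) \/
    [/\ x1 = x2, y1 = y2, y1 != 0 & 2%:R * y1 * l = 3%:R * x1 ^+ 2 + a4 W] ->
    square_mod ((x1%:P - 'X) * (x2%:P - 'X) * delta (ec_line l x1 y1 x2)).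
  move=> /(line_coefs xy1 xy2) [_ e4 e6]; rewrite /ec_line /=.
  exists (l%:P * 'X + (y1 - l * x1)%:P), (-1); rewrite /cubic_poly e4 e6.
  by ring.
case: eqVneq => [e1|x12] /=; last first.
  by apply: line; left; split=> //; rewrite divfK // subr_eq0 eq_sym.
case: eqVneq => [_|y12] /=.
  by exists (x1%:P - 'X), 0; rewrite e1; ring.
apply: line; right.
have e : y2 = y1.
  have : (y2 - y1) * (y2 + y1) = 0 by rewrite -subr_sqr xy1 xy2 e1 subrr.
  move/eqP; rewrite mulf_eq0 subr_eq0 addr_eq0 => /orP [/eqP //|/eqP ey].
  by rewrite ey opprK eqxx in y12.
have y0 : y1 != 0 by apply: contra_neq y12 => y0; rewrite e y0 oppr0.
by split=> //; rewrite mulrC divfK // mulf_neq0.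
Qed.

(** The polynomial p represents the image of P: modulo squares, an element is its own inverse. *)
Definition in_class (P : G) (p : {poly F}) : Prop := square_mod (delta (val P) * p).

Lemma in_class_delta P : in_class P (delta (val P)).
Proof. by exists (delta (val P)), 0; ring. Qed.

Lemma in_class0 : in_class 0 1.
Proof. by exists 1, 0; rewrite /=; ring. Qed.

Lemma in_classD P Q p q : in_class P p -> in_class Q q -> in_class (P + Q) (p * q).
Proof.
move=> Pp Qq; apply: (@square_mod_cancel (val P)); apply: (@square_mod_cancel (val Q)).
have := square_modM (square_modM Pp Qq) (delta_add (ec_groupP P) (ec_groupP Q)).
by congr square_mod; rewrite val_ecg_add; ring.
Qed.

Lemma no_two_torsion (R : G) : R + R = 0 -> R = 0.
Proof.
case: R => -[|x y] HR e; apply: val_inj => //=; move/(congr1 val): e => /=.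
rewrite eqxx /=; case: eqVneq => // ey _.
have y0 : y = 0.
  apply/eqP; rewrite -(mulrI_eq0 _ (lregP two_neq0)).
  by rewrite mulr2n mulrDl mul1r {1}ey addNr.
by have := no_root x; move/eqP: HR => /= <-; rewrite y0 expr0n eqxx.
Qed.

(** Infinite descent. In a relation the odd coefficients select points whose sum is in 2G, so the
    product of their images is a square and no coefficient is odd. Since there is no 2-torsion the
    relation can be halved, so every power of 2 divides each coefficient. *)
Lemma descent n (P : 'I_n -> G) :
  (forall b : 'I_n -> bool, square_mod (\prod_(i | b i) delta (val (P i))) ->
     forall i, b i = false) ->
  forall k : 'I_n -> int, \sum_i P i *~ k i = 0 -> forall i, k i = 0.
Proof.
move=> indep k k0.
have half (k1 : 'I_n -> int) : \sum_i P i *~ k1 i = 0 ->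
    exists2 k2, \sum_i P i *~ k2 i = 0 & forall i, k1 i = 2 * k2 i.
  move=> k10; pose b i := odd `|k1 i|%N; pose k2 i := (k1 i %/ 2)%Z.
  have kE i : k1 i = (b i : nat)%:Z + 2 * k2 i.
    by rewrite /b /k2; lia.
  have PE : \sum_i P i *~ k1 i =
      \sum_(i | b i) P i + (\sum_i P i *~ k2 i + \sum_i P i *~ k2 i).
    rewrite [X in X + _]big_mkcond -!big_split /=; apply: eq_bigr => i _.
    rewrite {1}kE mulrzDr mulrC mulrzA; congr (_ + _).
    by case: (b i).
  have cl : in_class (\sum_(i | b i) P i) (\prod_(i | b i) delta (val (P i))).
    elim/big_ind2: _ => [|p q r s|i _]; first exact: in_class0.
      by move=> h1 h2; apply: in_classD.
    exact: in_class_delta.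
  set R := \sum_i P i *~ k2 i in PE.
  (* The class of the relation is the product over odd coefficients times [delta R ^+ 2]; cancelling
     this square leaves a square product. *)
  have := in_classD cl (in_classD (in_class_delta R) (in_class_delta R)).
  rewrite -PE k10 /in_class /= mul1r -expr2 => /square_mod_cancel /indep b0.
  exists k2; last by move=> i; rewrite {1}kE b0 add0r.
  apply: no_two_torsion; rewrite -/R; move: PE.
  by rewrite k10 big_pred0 // add0r => <-.
have div m : exists2 k2, \sum_i P i *~ k2 i = 0 & forall i, k i = 2 ^+ m * k2 i.
  elim: m => [|m [j j0 kE]]; first by exists k => // i; rewrite mul1r.
  have [k2 k20 jE] := half j j0; exists k2 => // i.
  by rewrite kE jE exprSr mulrA.
(* The power 2^|k i| exceeds |k i|, so a multiple of it with this absolute value is 0. *)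
move=> i; have [k2 _ /(_ i) e] := div `|k i|%N.
have : (`|k i| < 2 ^ `|k i|)%N by apply: ltn_expl.
rewrite {1}e abszM abszX /=; case: (absz (k2 i)) (absz_eq0 (k2 i)) => [/esym/eqP k0i _|m _].
  by rewrite e k0i mulr0.
by rewrite mulnS -[X in (_ < X)%N]addn0 ltn_add2l.
Qed.

End Descent.

(** * Local obstructions to being a square modulo the cubic *)

Lemma prime_bezoutz (l : nat) (a : int) :
  prime l -> ~~ (l%:Z %| a)%Z -> exists u v : int, u * a + v * l%:Z = 1.
Proof.
move=> pl la; have /coprimezP [[u v] e] : coprimez a l.
  by rewrite coprimezE coprime_sym prime_coprime // -dvdzE.
by exists u, v.
Qed.

(** As long as l divides D it divides G too, and l^2 cancels throughout. The bound |D|^2 < l^k keeps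
    a factor l in the modulus until D is invertible modulo l. *)
Lemma square_residue (l k : nat) (D G c : int) : prime l -> D != 0 ->
  (`|D| ^ 2 < l ^ k)%N -> (l%:Z ^+ k %| D ^+ 2 * c - G ^+ 2)%Z ->
  exists w : int, (l%:Z %| c - w ^+ 2)%Z.
Proof.
move=> pl; have [n] := ubnP `|D|%N; elim: n D G k => // n IH D G k ltDn D0 Dk dv.
have l0 : l%:Z != 0 by have := prime_gt0 pl; lia.
have D0' : (0 < `|D|)%N by rewrite absz_gt0.
case: k Dk dv => [|k] Dk /dvdzP [m me].
  by move: Dk; rewrite expn0 ltnS leqn0 expn_eq0 eqn0Ngt D0'.
have [/dvdzP [D1 DE]|lD] := boolP (l%:Z %| D)%Z; last first.
  have [u [v uv]] := prime_bezoutz pl lD; exists (u * G).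
  apply/dvdzP; exists (u ^+ 2 * (m * l%:Z ^+ k) + c * v * (1 + u * D)).
  have -> : c - (u * G) ^+ 2 =
      u ^+ 2 * (D ^+ 2 * c - G ^+ 2) + c * (1 - u * D) * (1 + u * D) by ring.
  have -> : 1 - u * D = v * l%:Z by rewrite -uv; ring.
  by rewrite me (exprS l%:Z); move: (l%:Z) => L; ring.
case: k Dk me => [|k] Dk me.
  have lD : (l <= `|D|)%N by apply: dvdn_leq => //; rewrite DE abszM dvdn_mull.
  move: Dk; rewrite expn1 ltnNge.
  by rewrite (leq_trans lD) // expnS expn1 leq_pmull.
have /dvdzP [G1 GE] : (l%:Z %| G)%Z.
  have : (l%:Z %| G ^+ 2)%Z.
    apply/dvdzP; exists (D1 ^+ 2 * l%:Z * c - m * l%:Z ^+ k.+1).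
    rewrite -[LHS](subKr (D ^+ 2 * c)) me DE !(exprS l%:Z).
    by move: (l%:Z) => L; ring.
  by rewrite !dvdzE abszX /= Euclid_dvdX // andbT.
have D10 : D1 != 0 by apply: contra_neq D0 => D10; rewrite DE D10 mul0r.
apply: (IH D1 G1 k) => //.
- apply: leq_trans (_ : (`|D| <= n)%N); last by [].
  by rewrite DE abszM ltn_Pmulr ?prime_gt1 // absz_gt0.
- have l1 : (0 < l ^ 2)%N by rewrite expn_gt0 prime_gt0.
  have Dl : (`|D1| * l = `|D|)%N by rewrite DE abszM.
  by rewrite -(ltn_pmul2r l1) -expnMn Dl -expnD addn2.
apply/dvdzP; exists m; apply: (mulfI (expf_neq0 2 l0)).
transitivity (D ^+ 2 * c - G ^+ 2); first by rewrite DE GE; ring.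
by rewrite me !(exprS l%:Z); move: (l%:Z) => L; ring.
Qed.

Section Local.
Variables (W : weierstrass rat) (A B : int).
Hypotheses (HA : a4 W = A%:~R) (HB : 4%:R * a6 W = B%:~R).

(* Four times the cubic, which has integer coefficients on E_pqrs. *)
Definition cubic4 (x : int) : int := 4 * x ^+ 3 + 4 * A * x + B.

Lemma cubic4E (x : int) : (cubic4 x)%:~R = 4%:R * (cubic_poly W).[x%:~R] :> rat.
Proof.
rewrite /cubic4 /cubic_poly !hornerE /= !(rmorphD, rmorphM, rmorphXn) /= -HB -HA.
by ring.
Qed.

Lemma hensel (l : nat) (x0 : int) k : prime l ->
  (l%:Z %| cubic4 x0)%Z -> ~~ (l%:Z %| 12 * x0 ^+ 2 + 4 * A)%Z ->
  exists x, (l%:Z %| x - x0)%Z /\ (l%:Z ^+ k.+1 %| cubic4 x)%Z.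
Proof.
move=> pl f0 df0; elim: k => [|k [x [/dvdzP [m xx0] /dvdzP [c fx]]]].
  by exists x0; rewrite subrr dvdz0.
have dfx : ~~ (l%:Z %| 12 * x ^+ 2 + 4 * A)%Z.
  apply: contra df0 => /dvdzP [n e]; apply/dvdzP.
  exists (n - 12 * m * (x + x0)).
  have -> : (n - 12 * m * (x + x0)) * l%:Z = n * l%:Z - 12 * (m * l%:Z) * (x + x0).
    by move: (l%:Z) => L; ring.
  by rewrite -e -xx0; ring.
have [u [v uv]] := prime_bezoutz pl dfx.
(* A Newton step, with u the inverse of the derivative modulo l; the Taylor expansion below is
   exact. *)
pose h := - (c * u) * l%:Z ^+ k.+1; exists (x + h); split.
  apply/dvdzP; exists (m - c * u * l%:Z ^+ k).
  by rewrite addrAC xx0 /h exprS; move: (l%:Z) => L; ring.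
have -> : cubic4 (x + h) = cubic4 x + h * (12 * x ^+ 2 + 4 * A)
    + h ^+ 2 * (12 * x + 4 * h) by rewrite /cubic4; ring.
apply/dvdzP; exists (c * v + (c * u) ^+ 2 * l%:Z ^+ k * (12 * x + 4 * h)).
have -> : cubic4 x + h * (12 * x ^+ 2 + 4 * A) = c * v * l%:Z ^+ k.+2.
  have vE : v * l%:Z = 1 - u * (12 * x ^+ 2 + 4 * A).
    by rewrite addrC; apply: (canRL (addKr _)).
  have -> : c * v * l%:Z ^+ k.+2 = c * (v * l%:Z) * l%:Z ^+ k.+1.
    by rewrite (exprS l%:Z k.+1); move: (l%:Z ^+ k.+1) (l%:Z) => L1 L; ring.
  by rewrite vE fx /h; move: (l%:Z ^+ k.+1) => L1; ring.
by rewrite {1}/h !(exprS l%:Z); move: (l%:Z) => L; ring.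
Qed.

(** The simple root x0 lifts to a root x modulo a high power of l. Evaluating the square modulo the
    cubic at x, after clearing denominators, leaves a congruence for [square_residue]; finally x is
    replaced by x0 modulo l. *)
Lemma square_mod_local (l : nat) n (X : 'I_n -> int) (b : pred 'I_n) (x0 : int) :
  prime l -> (l%:Z %| cubic4 x0)%Z -> ~~ (l%:Z %| 12 * x0 ^+ 2 + 4 * A)%Z ->
  square_mod W (\prod_(i | b i) ((X i)%:~R%:P - 'X)) ->
  exists w : int, (l%:Z %| \prod_(i | b i) (X i - x0) - w ^+ 2)%Z.
Proof.
move=> pl f0 df0 [g [h gh]].
have [G [a a0 gE]] := rat_poly_scale g.
have [H [c c0 hE]] := rat_poly_scale h.
(* The factor D clears the denominators a of g and c of h, and the factor 4 of [cubic4]. *)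
pose D := 2 * a * c; have D0 : D != 0 by rewrite !mulf_neq0.
pose P x := \prod_(i | b i) (X i - x).
have key x : D ^+ 2 * P x = (2 * c * G.[x]) ^+ 2 + cubic4 x * (a ^+ 2 * c * H.[x]).
  apply: (@intr_inj rat); move: (cubic4E x); move: (cubic4 x) => f4 f4E.
  rewrite !(rmorphD, rmorphM, rmorphXn) /= f4E.
  have -> : (P x)%:~R = (\prod_(i | b i) ((X i)%:~R%:P - 'X)).[x%:~R] :> rat.
    rewrite horner_prod /P rmorph_prod; apply: eq_bigr => i _.
    by rewrite !hornerE rmorphB.
  rewrite gh (expr2 g) hornerD !hornerM gE hE !hornerZ !horner_map /=.
  by field; rewrite !intr_eq0 a0 c0.
(* The exponent |D|^2 + 1 ensures that the power of l exceeds |D|^2. *)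
have [x [/dvdzP [m xx0] dv]] := hensel (`|D| ^ 2)%N pl f0 df0.
have [||w] := @square_residue l (`|D| ^ 2).+1 D (2 * c * G.[x]) (P x) pl D0.
- exact: leq_trans (ltn_expl _ (prime_gt1 pl)) (leq_pexp2l (prime_gt0 pl) (leqnSn _)).
- by rewrite key addrAC subrr add0r dvdz_mulr.
move=> dw; exists w; rewrite -(subrKA (P x)) rpredD //.
have -> : x0 = x - m * l%:Z by rewrite -xx0 subKr.
rewrite /P; apply: (big_ind2 (fun p q => (l%:Z %| p - q)%Z)) => [|p q r s pq rs|i _].
- by rewrite subrr dvdz0.
- have -> : p * r - q * s = (p - q) * r + q * (r - s) by ring.
  by rewrite rpredD //; [apply: dvdz_mulr | apply: dvdz_mull].
by apply/dvdzP; exists m; move: (l%:Z) => L; ring.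
Qed.

End Local.

(** * A computable independence criterion *)

Definition descent_prod (R : comNzRingType) (x0 : R) (xs : seq R) (b : seq bool) : R :=
  foldr (fun bx r => if bx.1 then (bx.2 - x0) * r else r) 1 (zip b xs).

(** The nonzero derivative makes the root x0 liftable; nonsquareness is decided by listing all
    squares modulo l. *)
Definition obstruction (l : nat) (x0 A B : 'Z_l) (xs : seq 'Z_l) (b : seq bool) :
    bool :=
  [&& 4%:R * x0 ^+ 3 + 4%:R * A * x0 + B == 0, 12%:R * x0 ^+ 2 + 4%:R * A != 0
    & all (fun w : nat => w%:R ^+ 2 != descent_prod x0 xs b) (iota 0 l)].

Definition rootless (l : nat) (A B : 'Z_l) : bool :=
  all (fun z : nat => 4%:R * z%:R ^+ 3 + 4%:R * A * z%:R + B != 0) (iota 0 l).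

Lemma dvdz_Zp (l : nat) (a : int) : prime l -> (l%:Z %| a)%Z = (a%:~R == 0 :> 'Z_l).
Proof.
move=> pl; apply: dvdz_pcharf.
by rewrite inE pl /= pchar_Zp ?prime_gt1.
Qed.

Lemma Zp_natr_val (l : nat) (z : 'Z_l) : (1 < l)%N -> exists2 n : nat, n \in iota 0 l & z = n%:R.
Proof.
move=> l1; exists z; last by rewrite natr_Zp.
by rewrite mem_iota /= add0n -[X in (_ < X)%N](Zp_cast l1) ltn_ord.
Qed.

Lemma descent_prodE n (xs : seq int) (b : 'I_n -> bool) (x0 : int) : size xs = n ->
  \prod_(i | b i) (xs`_i - x0) = descent_prod x0 xs [seq b i | i <- enum 'I_n].
Proof.
move=> sxs; set bs := map _ _.
have sbs : size bs = n by rewrite size_map size_enum_ord.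
have -> : descent_prod x0 xs bs = \prod_(bx <- zip bs xs | bx.1) (bx.2 - x0).
  rewrite /descent_prod; elim: (zip bs xs) => [|bx z IH]; first by rewrite big_nil.
  by rewrite big_cons /= IH.
rewrite (big_nth (false, 0)) size_zip sbs sxs minnn big_mkord.
apply: eq_big => i; rewrite nth_zip ?sbs ?sxs //= (nth_map i) ?size_enum_ord //.
by rewrite nth_ord_enum.
Qed.

Lemma descent_prod_intr (l : nat) (x0 : int) (xs : seq int) b :
  (descent_prod x0 xs b)%:~R = descent_prod x0%:~R (map intr xs) b :> 'Z_l.
Proof.
elim: xs b => [|x xs IH] [|[] b] //; last exact: IH.
by rewrite /descent_prod /= -/(descent_prod x0 xs b) rmorphM rmorphB /= IH.
Qed.

(** A rational root whose denominator is prime to l reduces to a root modulo l. If l divided the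
    denominator it would divide 4 times the cube of the numerator, hence the numerator, as l is
    odd. *)
Lemma rootless_rat (W : weierstrass rat) (A B : int) (l : nat) :
  a4 W = A%:~R -> 4%:R * a6 W = B%:~R -> prime l -> (2 < l)%N ->
  @rootless l A%:~R B%:~R -> forall x, x ^+ 3 + a4 W * x + a6 W != 0.
Proof.
move=> HA HB pl l2 /allP nr x; apply/eqP => x0.
have eqn : 4 * numq x ^+ 3 + 4 * A * numq x * denq x ^+ 2 + B * denq x ^+ 3 = 0.
  apply: (@intr_inj rat); rewrite !(rmorphD, rmorphM, rmorphXn) /= -HA -HB.
  have d0 : (denq x)%:~R != 0 :> rat by rewrite intr_eq0 denq_eq0.
  have -> : (numq x)%:~R = x * (denq x)%:~R :> rat by rewrite -{2}(divq_num_den x) divfK.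
  rewrite -[RHS](mulr0 (4%:R * (denq x)%:~R ^+ 3)) -x0; ring.
have [dl|dl] := boolP (l%:Z %| denq x)%Z.
  have : (l%:Z %| numq x)%Z.
    have : (l%:Z %| 4 * numq x ^+ 3)%Z.
      rewrite -[X in (_ %| X)%Z](addrK (4 * A * numq x * denq x ^+ 2 + B * denq x ^+ 3)).
      rewrite addrA eqn sub0r rpredN rpredD //; apply: dvdz_mull => //.
        exact: dvdz_exp.
      exact: dvdz_exp.
    rewrite !dvdzE abszM abszX /= Euclid_dvdM // Euclid_dvdX // andbT.
    case/orP => // l4; have : (l %| 2 ^ 2)%N by [].
    by rewrite Euclid_dvdX // andbT => /(dvdn_leq (isT : (0 < 2)%N)); rewrite leqNgt l2.
  move=> nl; have := coprime_num_den x; rewrite /coprime.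
  have : (l %| gcdn `|numq x| `|denq x|)%N by move: nl dl; rewrite dvdn_gcd !dvdzE => -> ->.
  by move=> dg /eqP e; move: dg; rewrite e dvdn1 => /eqP l1; have := prime_gt1 pl; rewrite l1.
have [u [v uv]] := prime_bezoutz pl dl.
have [n nI nE] := Zp_natr_val (numq x * u)%:~R (prime_gt1 pl).
move: (nr n nI); rewrite -nE => /negP; apply.
have u1 : u%:~R * (denq x)%:~R = 1 :> 'Z_l.
  have := congr1 (fun z : int => z%:~R : 'Z_l) uv.
  by rewrite rmorphD !rmorphM /= -[l%:~R]/(l%:R) pchar_Zp ?prime_gt1 // mulr0 addr0.
have := congr1 (fun z : int => (u ^+ 3 * z)%:~R : 'Z_l) eqn; rewrite mulr0 => e.
apply/eqP; rewrite -[RHS]e !(rmorphD, rmorphM, rmorphXn) /=.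
move: u1; move: (u%:~R) (numq x)%:~R (denq x)%:~R (A%:~R) (B%:~R) => U N D a b UD.
transitivity (4%:R * (N * U) ^+ 3 + 4%:R * a * (N * U) * (U * D) ^+ 2 + b * (U * D) ^+ 3).
  by rewrite UD !expr1n !mulr1.
by ring.
Qed.

Lemma independence_criterion (W : weierstrass rat) (A B : int) n (xs : seq int)
    (P : 'I_n -> point rat) (l0 : nat) :
  elliptic W -> a4 W = A%:~R -> 4%:R * a6 W = B%:~R ->
  size xs = n -> (forall i, on_curve W (P i)) ->
  (forall i, exists y, P i = Affine (xs`_i)%:~R y) ->
  prime l0 -> (2 < l0)%N -> @rootless l0 A%:~R B%:~R ->
  (forall b : seq bool, size b = n -> has id b -> exists l (x0 : nat),
     prime l /\ @obstruction l x0%:R A%:~R B%:~R (map intr xs) b) ->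
  forall k : 'I_n -> int, ec_comb W k P = Infinity -> forall i, k i = 0.
Proof.
move=> smooth HA HB sxs Pon Pxs pl0 l02 rl obs k k0.
have no_root := rootless_rat HA HB pl0 l02 rl.
have two0 : (2%:R : rat) != 0 by [].
pose Q i : ec_group two0 smooth := exist _ (P i) (introT (on_curveP W _) (Pon i)).
have QE i : val (Q i) = P i by [].
apply: (@descent _ _ two0 smooth no_root n Q); last first.
  by apply: val_inj; rewrite val_ecg_comb.
move=> b sq i; apply/negP => bi.
set bs := [seq b i | i <- enum 'I_n].
have [||l [x0 [pl /and3P [r0 d0 /allP ns]]]] := obs bs.
- by rewrite size_map size_enum_ord.
- by apply/hasP; exists true => //; rewrite -bi map_f ?mem_enum.
have [|||w] := @square_mod_local W A B HA HB l n (fun i => xs`_i) b x0 pl.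
- by rewrite dvdz_Zp // /cubic4 !(rmorphD, rmorphM, rmorphXn, rmorph_nat) /= -pmulrn.
- rewrite dvdz_Zp //; apply: contraNneq d0 => <-.
  by rewrite pmulrn; apply/eqP; ring.
- rewrite (eq_bigr (fun i => (delta (val (Q i))))) // => j _.
  by rewrite QE; have [y ->] := Pxs j.
rewrite descent_prodE // dvdz_Zp // rmorphB rmorphXn /=.
rewrite descent_prod_intr -pmulrn.
have [m mI ->] := Zp_natr_val w%:~R (prime_gt1 pl).
by rewrite subr_eq0 eq_sym => e; have := ns m mI; rewrite e.
Qed.

(** * Points on the curves [E_pqrs] *)

(** [curveA] and [curveB] are a4 and 4 a6 of [E_pqrs], with integer coefficients and in a form that
    shows the symmetries p <-> q and r <-> s. *)
Definition curveA (R : comNzRingType) (p q r s : R) : R := - 3%:R * (p * q * r * s) ^+ 2.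
Definition curveB (R : comNzRingType) (p q r s : R) : R :=
  (p ^+ 6 + q ^+ 6 - r ^+ 6 - s ^+ 6) ^+ 2 - 4%:R * (p ^+ 6 * q ^+ 6 + r ^+ 6 * s ^+ 6).

(** Abscissas of the points used in the descent: four sections and, in the fifth place, the extra
    point of [extra_on_curve]. *)
Definition xcoords (R : comNzRingType) (u v p q r s k : R) : seq R :=
  [:: p ^+ 2 * s ^+ 2 + q ^+ 2 * r ^+ 2; p ^+ 2 * q ^+ 2 + r ^+ 2 * s ^+ 2;
      p ^+ 2 * r ^+ 2 + q ^+ 2 * s ^+ 2; u ^+ 2 * s ^+ 2 + v ^+ 2 * r ^+ 2;
      55%:R * k ^+ 2 + 12%:R * (r ^+ 2 - s ^+ 2) * k].

Section Family.
Variable F : fieldType.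
Hypothesis two_neq0 : (2%:R : F) != 0.
Implicit Types u v p q r s k : F.

Lemma four_neq0 : (4%:R : F) != 0.
Proof. by rewrite (natrM F 2 2) mulf_neq0. Qed.

Lemma a6_E_pqrs p q r s : 4%:R * a6 (E_pqrs p q r s) = curveB p q r s.
Proof.
rewrite /= mulrBr mulrDr (mulrA 4%:R 4%:R^-1) mulfV ?four_neq0 // mul1r /curveB.
by ring.
Qed.

Lemma on_curve_half (W : weierstrass F) x z :
  z ^+ 2 = 4%:R * x ^+ 3 + 4%:R * a4 W * x + 4%:R * a6 W ->
  on_curve W (Affine x (z / 2%:R)).
Proof.
move=> zE; apply: (mulfI four_neq0).
rewrite expr_div_n mulrCA -(natrX F 2 2) mulfV ?mulr1 ?four_neq0 // zE.
by ring.
Qed.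

Lemma on_E_pqrs p q r s x z :
  z ^+ 2 = 4%:R * x ^+ 3 + 4%:R * curveA p q r s * x + curveB p q r s ->
  on_curve (E_pqrs p q r s) (Affine x (z / 2%:R)).
Proof. by rewrite -a6_E_pqrs => zE; apply: (@on_curve_half (E_pqrs p q r s)). Qed.

Definition sections (u v p q r s : F) : seq (point F) :=
  [:: Affine (p ^+ 2 * s ^+ 2 + q ^+ 2 * r ^+ 2) ((p ^+ 6 + s ^+ 6 - q ^+ 6 - r ^+ 6) / 2%:R);
      Affine (p ^+ 2 * q ^+ 2 + r ^+ 2 * s ^+ 2) ((p ^+ 6 + q ^+ 6 - r ^+ 6 - s ^+ 6) / 2%:R);
      Affine (p ^+ 2 * r ^+ 2 + q ^+ 2 * s ^+ 2) ((p ^+ 6 + r ^+ 6 - q ^+ 6 - s ^+ 6) / 2%:R);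
      Affine (u ^+ 2 * s ^+ 2 + v ^+ 2 * r ^+ 2) ((u ^+ 6 + s ^+ 6 - v ^+ 6 - r ^+ 6) / 2%:R);
      Affine (u ^+ 2 * r ^+ 2 + v ^+ 2 * s ^+ 2) ((u ^+ 6 + r ^+ 6 - v ^+ 6 - s ^+ 6) / 2%:R)].

Lemma sections_on_curve3 u v p q r s i : (i < 3)%N ->
  on_curve (E_pqrs p q r s) (nth Infinity (sections u v p q r s) i).
Proof. by case: i => [|[|[|//]]] _; apply: on_E_pqrs; rewrite /curveA /curveB; ring. Qed.

(** On C, u^6 + v^6 - r^6 - s^6 is the opposite of p^6 + q^6 - r^6 - s^6, and [curveB] contains only
    its square. *)
Lemma E_pqrs_uv u v p q r s : u * v = p * q ->
  u ^+ 6 + v ^+ 6 + p ^+ 6 + q ^+ 6 = 2%:R * (r ^+ 6 + s ^+ 6) ->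
  curveA u v r s = curveA p q r s /\ curveB u v r s = curveB p q r s.
Proof.
move=> uv e; split; first by rewrite /curveA uv.
have uE : u ^+ 6 = 2%:R * (r ^+ 6 + s ^+ 6) - v ^+ 6 - p ^+ 6 - q ^+ 6 by rewrite -e; ring.
by rewrite /curveB -!exprMn uv uE; ring.
Qed.

Lemma sections_on_curve u v p q r s i : u * v = p * q ->
  u ^+ 6 + v ^+ 6 + p ^+ 6 + q ^+ 6 = 2%:R * (r ^+ 6 + s ^+ 6) ->
  on_curve (E_pqrs p q r s) (nth Infinity (sections u v p q r s) i).
Proof.
move=> uv e; have [Auv Buv] := E_pqrs_uv uv e.
have [i3|] := ltnP i 3; first exact: sections_on_curve3.
case: i => [|[|[|[|[|i]]]]] // _ /=; last by rewrite nth_nil.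
  by apply: on_E_pqrs; rewrite -Auv -Buv /curveA /curveB; ring.
by apply: on_E_pqrs; rewrite -Auv -Buv /curveA /curveB; ring.
Qed.

(* On the curve of C given by r - s = u - v, r + s = p + q and
   (p q, r s) = (5 k, 3 k), the coefficients of E are polynomials in
   d = r^2 - s^2 and k, and this gives one more point. *)
Lemma extra_on_curve p q r s k : p * q = 5%:R * k -> r * s = 3%:R * k ->
  p ^+ 2 + q ^+ 2 = r ^+ 2 + s ^+ 2 - 4%:R * k ->
  on_curve (E_pqrs p q r s)
    (Affine (55%:R * k ^+ 2 + 12%:R * (r ^+ 2 - s ^+ 2) * k)
            ((k * (12%:R * (r ^+ 2 - s ^+ 2) ^+ 2 + 288%:R * (r ^+ 2 - s ^+ 2) * k
                   + 700%:R * k ^+ 2)) / 2%:R)).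
Proof.
move=> pq rs sum; apply: on_E_pqrs.
have -> : curveA p q r s = - 3%:R * ((p * q) * (r * s)) ^+ 2 by rewrite /curveA; ring.
have -> : curveB p q r s =
  ((p ^+ 2 + q ^+ 2) ^+ 3 - 3%:R * (p * q) ^+ 2 * (p ^+ 2 + q ^+ 2)
   - ((r ^+ 2 + s ^+ 2) ^+ 3 - 3%:R * (r * s) ^+ 2 * (r ^+ 2 + s ^+ 2))) ^+ 2
  - 4%:R * ((p * q) ^+ 6 + (r * s) ^+ 6) by rewrite /curveB; ring.
rewrite pq rs sum.
have : (r ^+ 2 + s ^+ 2) ^+ 2 = (r ^+ 2 - s ^+ 2) ^+ 2 + 4%:R * (r * s) ^+ 2 by ring.
rewrite rs; move: (r ^+ 2 + s ^+ 2) (r ^+ 2 - s ^+ 2) => sg d sg2.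
by ring: sg2.
Qed.

End Family.

(** A singular cubic has a rational root: 0 if a = 0, and otherwise 3 b / a, the companion of the
    double root - 3 b / (2 a). *)
Lemma elliptic_rootless (W : weierstrass rat) :
  (forall x, x ^+ 3 + a4 W * x + a6 W != 0) -> elliptic W.
Proof.
move=> nr; rewrite /elliptic /disc mulf_neq0 ?oppr_eq0 //; apply/eqP.
case: W nr => a b /= nr d0.
have [a0|a0] := eqVneq a 0.
  have := nr 0; rewrite a0 mulr0 expr0n /= !add0r => b0.
  move/eqP: d0; rewrite a0 expr0n /= mulr0 add0r mulf_eq0 expf_eq0 /=.
  by rewrite (negPf b0).
have := nr (3%:R * b / a); apply/negP; rewrite negbK; apply/eqP.
have -> : (3%:R * b / a) ^+ 3 + a * (3%:R * b / a) + b =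
  b * (4%:R * a ^+ 3 + 27%:R * b ^+ 2) / a ^+ 3 by field.
by rewrite d0 mulr0 mul0r.
Qed.

(** * Checking independence from residues *)

Fixpoint bitseqs (n : nat) : seq bitseq :=
  if n is n'.+1 then
    [seq true :: b | b <- bitseqs n'] ++ [seq false :: b | b <- bitseqs n']
  else [:: [::]].

Lemma mem_bitseqs n b : size b = n -> b \in bitseqs n.
Proof.
elim: n b => [|n IH] [|x b] //= [sb]; rewrite mem_cat.
by case: x; rewrite map_f ?orbT // IH.
Qed.

(* [res l] lists the residues modulo l of u, v, p, q, r, s, k, and each (l, x0)
   in [cs] gives the character P |-> (x(P) - x0 | l) on the curve. *)
Definition independence_check (n : nat) (res : nat -> seq nat) (l0 : nat)
    (cs : seq (nat * nat)) : bool :=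
  let X l i : 'Z_l := (nth 0 (res l) i)%N%:R in
  let A l := curveA (X l 2) (X l 3) (X l 4) (X l 5) in
  let B l := curveB (X l 2) (X l 3) (X l 4) (X l 5) in
  [&& prime l0, (2 < l0)%N, rootless (A l0) (B l0), all (fun c => prime c.1) cs
    & all (fun b => has id b ==> has (fun c =>
        obstruction c.2%:R (A c.1) (B c.1)
          (take n (xcoords (X c.1 0) (X c.1 1) (X c.1 2) (X c.1 3) (X c.1 4)
             (X c.1 5) (X c.1 6))) b) cs) (bitseqs n)]%N.

Definition has_residues (res : nat -> seq nat) (l : nat) (t : seq int) : Prop :=
  forall i, (i < 7)%N -> (t`_i)%:~R = (nth 0 (res l) i)%N%:R :> 'Z_l.

Section Morphism.
Variables (R S : comNzRingType) (f : {rmorphism R -> S}).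

Lemma curveA_morph p q r s : f (curveA p q r s) = curveA (f p) (f q) (f r) (f s).
Proof. by rewrite /curveA; ring. Qed.

Lemma curveB_morph p q r s : f (curveB p q r s) = curveB (f p) (f q) (f r) (f s).
Proof. by rewrite /curveB; ring. Qed.

Lemma xcoords_morph u v p q r s k :
  map f (xcoords u v p q r s k) = xcoords (f u) (f v) (f p) (f q) (f r) (f s) (f k).
Proof. by rewrite /xcoords /=; do ![congr (_ :: _); first by ring]. Qed.

End Morphism.

Definition E_int (t : seq int) : weierstrass rat :=
  E_pqrs (t`_2)%:~R (t`_3)%:~R (t`_4)%:~R (t`_5)%:~R.

Lemma independence_of_check n res l0 cs (t : seq int) (P : 'I_n -> point rat) :
  (n <= 5)%N -> independence_check n res l0 cs ->
  has_residues res l0 t -> (forall c, c \in cs -> has_residues res c.1 t) ->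
  (forall i, on_curve (E_int t) (P i)) ->
  (forall i : 'I_n, exists y, P i =
     Affine ((xcoords t`_0 t`_1 t`_2 t`_3 t`_4 t`_5 t`_6)`_i)%:~R y) ->
  elliptic (E_int t) /\
  forall k : 'I_n -> int, ec_comb (E_int t) k P = Infinity -> forall i, k i = 0.
Proof.
move=> n5 /and5P [pl0 l02 rl /allP pcs /allP chk] r0 rcs Pon Px.
set xs := xcoords _ _ _ _ _ _ _ in Px.
pose A := curveA t`_2 t`_3 t`_4 t`_5; pose B := curveB t`_2 t`_3 t`_4 t`_5.
have HA : a4 (E_int t) = A%:~R by rewrite curveA_morph.
have HB : 4%:R * a6 (E_int t) = B%:~R by rewrite curveB_morph a6_E_pqrs.
have AE l : has_residues res l t -> A%:~R = curveA (nth 0%N (res l) 2)%:R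
    (nth 0%N (res l) 3)%:R (nth 0%N (res l) 4)%:R (nth 0%N (res l) 5)%:R :> 'Z_l.
  by move=> rl'; rewrite curveA_morph /= !rl'.
have BE l : has_residues res l t -> B%:~R = curveB (nth 0%N (res l) 2)%:R
    (nth 0%N (res l) 3)%:R (nth 0%N (res l) 4)%:R (nth 0%N (res l) 5)%:R :> 'Z_l.
  by move=> rl'; rewrite curveB_morph /= !rl'.
have rl' : @rootless l0 A%:~R B%:~R by rewrite AE // BE.
have ell := elliptic_rootless (rootless_rat HA HB pl0 l02 rl').
split=> //; apply: (independence_criterion ell HA HB (xs := take n xs) _ _ _ pl0 l02 rl') => //.
- by rewrite size_takel.
- by move=> i; rewrite nth_take.
move=> b sb hb; have /implyP /(_ hb) /hasP [[l x0] ccs ob] := chk b (mem_bitseqs sb).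
exists l, x0; split; first exact: (pcs _ ccs).
have rc := rcs _ ccs; rewrite map_take xcoords_morph AE // BE //=.
by rewrite !rc.
Qed.

(** * A point of C where the five sections are independent *)

(** The slope is supplied as data, so only polynomial identities remain to be checked. *)
Lemma ec_add_chord (F : fieldType) (W : weierstrass F) (x1 y1 x2 y2 l x3 y3 : F) :
  x1 != x2 -> l * (x2 - x1) = y2 - y1 ->
  x3 = l ^+ 2 - x1 - x2 -> y3 = l * (x1 - x3) - y1 ->
  ec_add W (Affine x1 y1) (Affine x2 y2) = Affine x3 y3.
Proof.
move=> x12 lE x3E y3E; rewrite /= x12 -lE mulfK ?subr_eq0 1?eq_sym //.
by rewrite /ec_line -x3E -y3E.
Qed.

Section BasePoint.
Variable F : realFieldType.

(** This point is [coords (15, 17, 25, 2)] divided by 25 (by 25^2 for k), so pq = 5 k and rs = 3 k,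
    and [extra_on_curve] gives the point Q = (Qx, Qy). *)
Let u : F := 75%:R * 91%:R.
Let v : F := 68%:R * 11%:R.
Let p : F := 75%:R * 11%:R.
Let q : F := 68%:R * 91%:R.
Let r : F := 77%:R * 85%:R.
Let s : F := 468%:R.
Let k : F := 165%:R * (68%:R * 91%:R).
Let W := E_pqrs p q r s.
Let P i := nth Infinity (sections u v p q r s) i.
Let d := r ^+ 2 - s ^+ 2.
Let Qx := 55%:R * k ^+ 2 + 12%:R * d * k.
Let Qy := k * (6%:R * d ^+ 2 + 144%:R * d * k + 350%:R * k ^+ 2).
(** With P 0, ..., P 4 the sections, M = P 1 - Q, A = P 0 + M, N = P 3 - Q and B = N - P 2. Large
    integers are written in base 1000 so that no unary numeral is large. *)
Let Mx := 55%:R * k ^+ 2 - 12%:R * d * k.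
Let My := k * (6%:R * d ^+ 2 - 144%:R * d * k + 350%:R * k ^+ 2).
Let Ax : F := ((((((2%:R * 1000%:R + 449%:R) * 1000%:R + 7%:R) * 1000%:R + 753%:R) * 1000%:R +
  488%:R) * 1000%:R + 65%:R) / 256%:R).
Let Ay : F := (((((((((45%:R * 1000%:R + 998%:R) * 1000%:R + 274%:R) * 1000%:R + 149%:R) *
  1000%:R + 846%:R) * 1000%:R + 391%:R) * 1000%:R + 567%:R) * 1000%:R + 372%:R) * 1000%:R +
  255%:R) / 16%:R ^+ 3).
Let Nx : F := (((((((3%:R * 1000%:R + 233%:R) * 1000%:R + 571%:R) * 1000%:R + 831%:R) * 1000%:R
  + 215%:R) * 1000%:R + 791%:R) * 1000%:R + 65%:R) / 1444%:R).
Let Ny : F := ((((((((((5%:R * 1000%:R + 846%:R) * 1000%:R + 792%:R) * 1000%:R + 105%:R) *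
  1000%:R + 224%:R) * 1000%:R + 559%:R) * 1000%:R + 40%:R) * 1000%:R + 678%:R) * 1000%:R +
  441%:R) * 1000%:R + 315%:R) / 38%:R ^+ 3).
Let Bx : F := ((((((169%:R * 1000%:R + 36%:R) * 1000%:R + 128%:R) * 1000%:R + 226%:R) * 1000%:R
  + 991%:R) * 1000%:R + 25%:R) / 289%:R).
Let By : F := ((- ((((((((88%:R * 1000%:R + 677%:R) * 1000%:R + 964%:R) * 1000%:R + 819%:R) *
  1000%:R + 819%:R) * 1000%:R + 911%:R) * 1000%:R + 951%:R) * 1000%:R + 229%:R) * 1000%:R +
  815%:R)) / 17%:R ^+ 3).

Local Ltac unfold_base :=
  rewrite /Ax /Ay /Nx /Ny /Bx /By /Mx /My /Qx /Qy /d /k /p /q /r /s /u /v.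

Lemma base_sum1 : ec_add W (P 1) (ec_opp (Affine Qx Qy)) = Affine Mx My.
Proof.
apply: (@ec_add_chord _ _ _ _ _ _ (- 12%:R * k)).
- by apply/negP => /eqP; unfold_base => e; lra.
- by unfold_base; field.
- by unfold_base; field.
- by unfold_base; field.
Qed.

Lemma base_sum2 : ec_add W (P 0) (Affine Mx My) = Affine Ax Ay.
Proof.
apply: (@ec_add_chord _ _ _ _ _ _ (- ((550%:R * 1000%:R + 821%:R) * 1000%:R + 535%:R) / 16%:R)).
- by apply/negP => /eqP; unfold_base => e; lra.
- by unfold_base; field.
- by unfold_base; field.
- by unfold_base; field.
Qed.

Lemma base_sum3 : ec_add W (P 3) (ec_opp (Affine Qx Qy)) = Affine Nx Ny.
Proof.
apply: (@ec_add_chord _ _ _ _ _ _ (- (((2%:R * 1000%:R + 29%:R) * 1000%:R + 707%:R) * 1000%:R +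
  995%:R) / 38%:R)).
- by apply/negP => /eqP; unfold_base => e; lra.
- by unfold_base; field.
- by unfold_base; field.
- by unfold_base; field.
Qed.

Lemma base_sum4 : ec_add W (Affine Nx Ny) (ec_opp (P 2)) = Affine Bx By.
Proof.
apply: (@ec_add_chord _ _ _ _ _ _ ((((34%:R * 1000%:R + 558%:R) * 1000%:R + 32%:R) * 1000%:R +
  159%:R) / 646%:R)).
- by apply/negP => /eqP; unfold_base => e; lra.
- by unfold_base; field.
- by unfold_base; field.
- by unfold_base; field.
Qed.

Lemma base_sum5 : ec_add W (Affine Ax Ay) (Affine Bx By) = P 4.
Proof.
apply: (@ec_add_chord _ _ _ _ _ _ (- (((13%:R * 1000%:R + 842%:R) * 1000%:R + 540%:R) * 1000%:R
  + 657%:R) / 272%:R)).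
- by apply/negP => /eqP; unfold_base => e; lra.
- by unfold_base; field.
- by unfold_base; field.
- by unfold_base; field.
Qed.

(** This reads P 4 = P 0 + P 1 - P 2 + P 3 - 2 Q. The sum of the five sections is thus divisible by
    2, so the descent cannot be applied to them directly and needs Q in place of P 4. *)
Lemma base_relation :
  ec_add W (ec_add W (P 0) (ec_add W (P 1) (ec_opp (Affine Qx Qy))))
    (ec_add W (ec_add W (P 3) (ec_opp (Affine Qx Qy))) (ec_opp (P 2))) = P 4.
Proof.
by rewrite base_sum1 base_sum2 base_sum3 base_sum4 base_sum5.
Qed.

End BasePoint.

Definition base_tuple : seq int :=
  [:: 75%:R * 91%:R; 68%:R * 11%:R; 75%:R * 11%:R; 68%:R * 91%:R; 77%:R * 85%:R;
      468%:R; 165%:R * (68%:R * 91%:R)].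

(** The last entry k exceeds one million; it is reduced factor by factor to keep unary numbers
    small. *)
Definition base_residues (l : nat) : seq nat :=
  [seq (n %% l)%N | n <- [:: 75 * 91; 68 * 11; 75 * 11; 68 * 91; 77 * 85; 468;
                             (165 %% l) * (68 * 91 %% l)]%N].

Definition base_chars : seq (nat * nat) :=
  [:: (31, 29); (41, 2); (43, 9); (61, 28); (61, 42)]%N.

Lemma base_check : independence_check 5 base_residues 37 base_chars.
Proof. by vm_compute. Qed.

Lemma base_has_residues l : prime l -> has_residues base_residues l base_tuple.
Proof.
move=> pl; have modE n : (n %% l)%N%:R = n%:R :> 'Z_l.
  by rewrite {2}(divn_eq n l) natrD natrM pchar_Zp ?prime_gt1 // mulr0 add0r.
move=> i; case: i => [|[|[|[|[|[|[|//]]]]]]] _; rewrite /base_tuple /base_residues /=;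
  by rewrite ?rmorphM ?rmorph_nat /= !(modE, natrM).
Qed.

Definition base_section (F : fieldType) (i : nat) : point F :=
  nth Infinity (sections (75%:R * 91%:R) (68%:R * 11%:R) (75%:R * 11%:R)
    (68%:R * 91%:R) (77%:R * 85%:R) 468%:R) i.
Definition base_curve (F : fieldType) : weierstrass F :=
  E_pqrs (75%:R * 11%:R) (68%:R * 91%:R) (77%:R * 85%:R) 468%:R.

Lemma base_on_C (F : fieldType) :
  let u : F := 75%:R * 91%:R in let v : F := 68%:R * 11%:R in
  let p : F := 75%:R * 11%:R in let q : F := 68%:R * 91%:R in
  let r : F := 77%:R * 85%:R in let s : F := 468%:R in
  u ^+ 6 + v ^+ 6 + p ^+ 6 + q ^+ 6 = 2%:R * (r ^+ 6 + s ^+ 6) /\ u * v = p * q.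
Proof. by split; ring. Qed.

Lemma base_section_on_curve (F : fieldType) i : (2%:R : F) != 0 ->
  on_curve (base_curve F) (base_section F i).
Proof.
by move=> two0; have [e uv] := base_on_C F; apply: sections_on_curve.
Qed.

Lemma base_extra (F : realFieldType) :
  let k : F := 165%:R * (68%:R * 91%:R) in
  let x := 55%:R * k ^+ 2 + 12%:R * ((77%:R * 85%:R) ^+ 2 - 468%:R ^+ 2) * k in
  exists y : F,
  [/\ on_curve (base_curve F) (Affine x y)
    & ec_add (base_curve F)
        (ec_add (base_curve F) (base_section F 0)
           (ec_add (base_curve F) (base_section F 1) (ec_opp (Affine x y))))
        (ec_add (base_curve F)
           (ec_add (base_curve F) (base_section F 3) (ec_opp (Affine x y)))
           (ec_opp (base_section F 2)))
      = base_section F 4].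
Proof.
move=> k x; pose d : F := (77%:R * 85%:R) ^+ 2 - 468%:R ^+ 2.
exists (k * (6%:R * d ^+ 2 + 144%:R * d * k + 350%:R * k ^+ 2)).
split; last exact: (base_relation F).
have two0 : (2%:R : F) != 0 by rewrite pnatr_eq0.
have -> : k * (6%:R * d ^+ 2 + 144%:R * d * k + 350%:R * k ^+ 2) =
    (k * (12%:R * d ^+ 2 + 288%:R * d * k + 700%:R * k ^+ 2)) / 2%:R.
  by move: k d {x} => k d; field.
by apply: extra_on_curve; rewrite // /k; ring.
Qed.

Lemma base_curveE : E_int base_tuple = base_curve rat.
Proof. by rewrite /E_int /= !rmorphM !rmorph_nat. Qed.

Lemma sum_ord5 (G : nmodType) (a : 'I_5 -> G) : \sum_i a i =
  a (Ordinal (isT : 0 < 5)%N) + a (Ordinal (isT : 1 < 5)%N) + a (Ordinal (isT : 2 < 5)%N)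
  + a (Ordinal (isT : 3 < 5)%N) + a (Ordinal (isT : 4 < 5)%N).
Proof.
rewrite !big_ord_recr big_ord0 /= add0r.
by congr (a _ + a _ + a _ + a _ + a _); apply: val_inj.
Qed.

Lemma mulrz_sum5 (G : zmodType) (b0 b1 b2 b3 b4 : G) (k0 k1 k2 k3 k4 : int) :
  b0 *~ k0 + b1 *~ k1 + b2 *~ k2 + b3 *~ k3
    + (b0 + (b1 - b4) + ((b3 - b4) - b2)) *~ k4 =
  b0 *~ (k0 + k4) + b1 *~ (k1 + k4) + b2 *~ (k2 - k4) + b3 *~ (k3 + k4)
    + b4 *~ (- k4 - k4).
Proof.
rewrite !(mulrzDr, mulrzBr, mulrzDl, mulrzBl, mulNrz, mulrNz).
by rewrite !addrA [LHS](ACl (1*5*2*6*3*10*4*8*7*9)).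
Qed.

(** The change from B to S has determinant -2, so it preserves independence over the integers. *)
Lemma independent_change (F : fieldType) (W : weierstrass F) (B S : nat -> point F) :
  (2%:R : F) != 0 -> elliptic W ->
  (forall i, (i < 5)%N -> on_curve W (B i)) ->
  (forall i, (i < 4)%N -> B i = S i) ->
  ec_add W (ec_add W (B 0%N) (ec_add W (B 1%N) (ec_opp (B 4%N))))
    (ec_add W (ec_add W (B 3%N) (ec_opp (B 4%N))) (ec_opp (B 2%N))) = S 4%N ->
  (forall k : 'I_5 -> int, ec_comb W k (fun i => B i) = Infinity -> forall i, k i = 0) ->
  forall k : 'I_5 -> int, ec_comb W k (fun i => S i) = Infinity -> forall i, k i = 0.
Proof.
move=> two0 ell Bon BE rel indep k k0.
pose G := ec_group two0 ell.
have lift P : on_curve W P -> {g : G | val g = P} by apply: ecg_mk.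
have [b0 b0E] := lift _ (Bon 0%N isT); have [b1 b1E] := lift _ (Bon 1%N isT).
have [b2 b2E] := lift _ (Bon 2%N isT); have [b3 b3E] := lift _ (Bon 3%N isT).
have [b4 b4E] := lift _ (Bon 4%N isT).
pose c4 := (b0 + (b1 - b4)) + ((b3 - b4) - b2).
pose g (i : 'I_5) : G := nth 0 [:: b0; b1; b2; b3; c4] i.
pose h (i : 'I_5) : G := nth 0 [:: b0; b1; b2; b3; b4] i.
have gE i : val (g i) = S i.
  case: i => -[|[|[|[|[|//]]]]] lti; rewrite /g /=; try by rewrite -BE.
  by rewrite -rel -b0E -b1E -b2E -b3E -b4E.
have hE i : val (h i) = B i by case: i => -[|[|[|[|[|//]]]]] lti.
pose i0 : 'I_5 := Ordinal (isT : 0 < 5)%N; pose i1 : 'I_5 := Ordinal (isT : 1 < 5)%N.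
pose i2 : 'I_5 := Ordinal (isT : 2 < 5)%N; pose i3 : 'I_5 := Ordinal (isT : 3 < 5)%N.
pose i4 : 'I_5 := Ordinal (isT : 4 < 5)%N.
pose m (i : 'I_5) : int := nth 0 [:: k i0 + k i4; k i1 + k i4; k i2 - k i4;
  k i3 + k i4; - k i4 - k i4] i.
have gm : \sum_i g i *~ k i = \sum_i h i *~ m i by rewrite !sum_ord5; apply: mulrz_sum5.
have m0 : forall i, m i = 0.
  apply: indep; have mE := val_ecg_comb m h; have kE := val_ecg_comb k g.
  have combE (f f' : 'I_5 -> point F) (n : 'I_5 -> int) : f =1 f' -> ec_comb W n f = ec_comb W n f'.
    by move=> ff; apply: eq_bigr => i _; rewrite ff.
  by rewrite -(combE _ _ _ hE) -mE -gm kE (combE _ _ _ gE).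
have k4 : k i4 = 0 by have := m0 i4; rewrite /m /=; lia.
case=> -[|[|[|[|[|//]]]]] lti; rewrite (bool_irrelevance lti isT).
- by have := m0 i0; rewrite /m /= k4 addr0.
- by have := m0 i1; rewrite /m /= k4 addr0.
- by have := m0 i2; rewrite /m /= k4 subr0.
- by have := m0 i3; rewrite /m /= k4 addr0.
exact: k4.
Qed.

Lemma base_tuple_cast1 (R : comNzRingType) :
  [/\ (base_tuple`_0)%:~R = 75%:R * 91%:R :> R,
      (base_tuple`_1)%:~R = 68%:R * 11%:R :> R
    & (base_tuple`_2)%:~R = 75%:R * 11%:R :> R].
Proof. by split; rewrite /= rmorphM !rmorph_nat. Qed.

Lemma base_tuple_cast2 (R : comNzRingType) :
  [/\ (base_tuple`_3)%:~R = 68%:R * 91%:R :> R,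
      (base_tuple`_4)%:~R = 77%:R * 85%:R :> R,
      (base_tuple`_5)%:~R = 468%:R :> R
    & (base_tuple`_6)%:~R = 165%:R * (68%:R * 91%:R) :> R].
Proof. by split; rewrite /= ?rmorphM ?rmorph_nat // rmorphM !rmorph_nat. Qed.

Lemma base_xcoords_nth (R : comNzRingType) i : (i < 5)%N ->
  ((xcoords base_tuple`_0 base_tuple`_1 base_tuple`_2 base_tuple`_3
     base_tuple`_4 base_tuple`_5 base_tuple`_6)`_i)%:~R =
  (xcoords (75%:R * 91%:R) (68%:R * 11%:R) (75%:R * 11%:R) (68%:R * 91%:R)
     (77%:R * 85%:R) 468%:R (165%:R * (68%:R * 91%:R)))`_i :> R.
Proof.
move=> i5; rewrite -(nth_map 0 0 intr) // xcoords_morph /=.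
have [e0 e1 e2] := base_tuple_cast1 R; have [e3 e4 e5 e6] := base_tuple_cast2 R.
by rewrite e0 e1 e2 e3 e4 e5 e6.
Qed.

Lemma base_points (F : realFieldType) : exists B : nat -> point F,
  [/\ forall i, (i < 5)%N -> on_curve (base_curve F) (B i),
      forall i, (i < 5)%N -> exists z, B i = Affine
        ((xcoords base_tuple`_0 base_tuple`_1 base_tuple`_2 base_tuple`_3
          base_tuple`_4 base_tuple`_5 base_tuple`_6)`_i)%:~R z,
      forall i, (i < 4)%N -> B i = base_section F i
    & ec_add (base_curve F)
        (ec_add (base_curve F) (B 0) (ec_add (base_curve F) (B 1) (ec_opp (B 4))))
        (ec_add (base_curve F) (ec_add (base_curve F) (B 3) (ec_opp (B 4)))
           (ec_opp (B 2)))
      = base_section F 4]%N.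
Proof.
have two0 : (2%:R : F) != 0 by rewrite pnatr_eq0.
have [y [yE rel]] := base_extra F; set x := (x in Affine x y) in yE rel.
exists (nth Infinity [:: base_section F 0; base_section F 1; base_section F 2;
                         base_section F 3; Affine x y]); split.
- by move=> [|[|[|[|[|//]]]]] _ //; apply: base_section_on_curve.
- move=> i i5; rewrite base_xcoords_nth //.
  by case: i i5 => [|[|[|[|[|//]]]]] _; eexists.
- by move=> [|[|[|[|//]]]].
exact: rel.
Qed.

Lemma base_sections_independent :
  elliptic (base_curve rat) /\
  forall k : 'I_5 -> int,
    ec_comb (base_curve rat) k (fun i => base_section rat i) = Infinity ->
    forall i, k i = 0.
Proof.
have two0 : (2%:R : rat) != 0 by [].
have [B [Bon Bx BE rel]] := base_points rat.
have Son i := base_section_on_curve i two0.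
have [||||ell indep] := @independence_of_check 5 base_residues 37 base_chars base_tuple
  (fun i => B i) isT base_check.
- exact: base_has_residues.
- have /allP pr : all (fun c => prime c.1) base_chars by [].
  by move=> c /pr; apply: base_has_residues.
- by move=> i; rewrite base_curveE; apply: Bon.
- move=> i; have [z Bz] := Bx i (ltn_ord i); exists z; rewrite Bz.
  congr (Affine _ z).
rewrite base_curveE in ell indep; split; first exact: ell.
exact: (independent_change two0 ell Bon BE rel indep).
Qed.

(** * Field extensions and sections over C *)

Section MapCurve.
Variables (F K : fieldType) (f : {rmorphism F -> K}).

Definition map_curve (W : weierstrass F) : weierstrass K :=
  Weierstrass (f (a4 W)) (f (a6 W)).
Definition map_point (P : point F) : point K :=
  if P is Affine x y then Affine (f x) (f y) else Infinity.

Lemma map_ec_opp P : map_point (ec_opp P) = ec_opp (map_point P).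
Proof. by case: P => //= x y; rewrite rmorphN. Qed.

Lemma map_ec_add W P Q :
  map_point (ec_add W P Q) = ec_add (map_curve W) (map_point P) (map_point Q).
Proof.
case: P Q => [|x1 y1] [|x2 y2] //=.
rewrite fmorph_eq -(rmorphN f y2) fmorph_eq.
have line l x y z : map_point (ec_line l x y z) = ec_line (f l) (f x) (f y) (f z).
  by rewrite /= !(rmorphB, rmorphM, rmorphXn).
case: ifP => _; last case: ifP => _ //; rewrite line fmorph_div.
  by rewrite !rmorphB.
by rewrite rmorphD !rmorphM !rmorph_nat.
Qed.

Lemma map_ec_comb W n (k : 'I_n -> int) (P : 'I_n -> point F) :
  map_point (ec_comb W k P) = ec_comb (map_curve W) k (fun i => map_point (P i)).
Proof.
rewrite /ec_comb (big_morph map_point (map_ec_add W) (id1 := Infinity)) //.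
apply: eq_bigr => i _.
have iterE m : map_point (iter m (ec_add W (P i)) Infinity) =
    iter m (ec_add (map_curve W) (map_point (P i))) Infinity.
  by elim: m => //= m IH; rewrite map_ec_add IH.
by case: (k i) => m; rewrite /ec_mulz ?map_ec_opp iterE.
Qed.

Lemma map_elliptic W : elliptic W -> elliptic (map_curve W).
Proof.
rewrite /elliptic; have -> : disc (map_curve W) = f (disc W) by rewrite /disc /=; ring.
by rewrite fmorph_eq0.
Qed.

End MapCurve.

(** Abscissas and doubled ordinates of [sections], free of division so that every ring morphism acts
    on them. *)
Definition sections_x (R : comNzRingType) (u v p q r s : R) : seq R :=
  [:: p ^+ 2 * s ^+ 2 + q ^+ 2 * r ^+ 2; p ^+ 2 * q ^+ 2 + r ^+ 2 * s ^+ 2;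
      p ^+ 2 * r ^+ 2 + q ^+ 2 * s ^+ 2; u ^+ 2 * s ^+ 2 + v ^+ 2 * r ^+ 2;
      u ^+ 2 * r ^+ 2 + v ^+ 2 * s ^+ 2].
Definition sections_2y (R : comNzRingType) (u v p q r s : R) : seq R :=
  [:: p ^+ 6 + s ^+ 6 - q ^+ 6 - r ^+ 6; p ^+ 6 + q ^+ 6 - r ^+ 6 - s ^+ 6;
      p ^+ 6 + r ^+ 6 - q ^+ 6 - s ^+ 6; u ^+ 6 + s ^+ 6 - v ^+ 6 - r ^+ 6;
      u ^+ 6 + r ^+ 6 - v ^+ 6 - s ^+ 6].

Lemma sections_x_morph (R S : comNzRingType) (f : {rmorphism R -> S}) u v p q r s i :
  f (sections_x u v p q r s)`_i = (sections_x (f u) (f v) (f p) (f q) (f r) (f s))`_i.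
Proof.
by case: i => [|[|[|[|[|i]]]]] /=; rewrite ?nth_nil ?rmorph0 //; ring.
Qed.

Lemma sections_2y_morph (R S : comNzRingType) (f : {rmorphism R -> S}) u v p q r s i :
  f (sections_2y u v p q r s)`_i = (sections_2y (f u) (f v) (f p) (f q) (f r) (f s))`_i.
Proof.
by case: i => [|[|[|[|[|i]]]]] /=; rewrite ?nth_nil ?rmorph0 //; ring.
Qed.

Lemma nth_sections (F : fieldType) (u v p q r s : F) i : (i < 5)%N ->
  nth Infinity (sections u v p q r s) i =
  Affine (sections_x u v p q r s)`_i ((sections_2y u v p q r s)`_i / 2%:R).
Proof. by case: i => [|[|[|[|[|//]]]]]. Qed.

Definition eval (t : 6.-tuple algC) : {rmorphism {mpoly rat[6]} -> algC} :=
  GRing.RMorphism.clone _ _ (meval (tnth t) \o map_mpoly (ratr : rat -> algC)) _.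

Lemma mpevalE h t : mpeval h t = eval t h.
Proof. by []. Qed.

Lemma mpevalX (t : 6.-tuple algC) (i : 'I_6) : mpeval 'X_i t = t`_i.
Proof. by rewrite /mpeval map_mpolyX mevalXU (tnth_nth 0). Qed.

Definition section_map (i : nat) : ratmap :=
  let X j : {mpoly rat[6]} := 'X_(inord j) in
  Ratmap (sections_x (X 0) (X 1) (X 2) (X 3) (X 4) (X 5))`_i
    ((sections_2y (X 0) (X 1) (X 2) (X 3) (X 4) (X 5))`_i * (2%:R^-1)%:MP) 1.

Lemma section_map_Z i t : mpeval (rmZ (section_map i)) t = 1.
Proof. by rewrite mpevalE rmorph1. Qed.

Lemma section_at_map i t : (i < 5)%N -> section_at (section_map i) t =
  nth Infinity (sections t`_0 t`_1 t`_2 t`_3 t`_4 t`_5) i.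
Proof.
move=> i5; rewrite /section_at section_map_Z oner_eq0 !divr1 nth_sections //.
have Xj j : (j < 6)%N -> eval t 'X_(inord j) = t`_j.
  by move=> j6; rewrite -mpevalE mpevalX inordK.
congr Affine.
  by rewrite mpevalE (sections_x_morph (eval t)) !Xj.
rewrite mpevalE -[rmY _]/(_ * (2%:R^-1)%:MP) rmorphM (sections_2y_morph (eval t)); congr (_ * _).
  by rewrite !Xj.
have e : ratr (2%:R^-1 : rat) = 2%:R^-1 :> algC by rewrite fmorphV rmorph_nat.
by rewrite -mpevalE /mpeval map_mpolyC mevalC -e.
Qed.

Lemma section_map_defined i t : defined_at (section_map i) t.
Proof. by apply/or3P; constructor 3; rewrite section_map_Z oner_neq0. Qed.

Section MapBase.
Variables (F K : fieldType) (f : {rmorphism F -> K}).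

Lemma map_base_section i : map_point f (base_section F i) = base_section K i.
Proof.
rewrite /base_section; have [i5|i5] := ltnP i 5; last by rewrite !nth_default.
rewrite !nth_sections // /map_point fmorph_div sections_x_morph sections_2y_morph.
by rewrite !rmorphM !rmorph_nat.
Qed.

Lemma map_base_curve : map_curve f (base_curve F) = base_curve K.
Proof.
congr Weierstrass; first by rewrite /=; ring.
by rewrite /= rmorphB rmorphD [f (_^-1 * _)]rmorphM fmorphV rmorph_nat; congr (_ + _ * _ - _); ring.
Qed.

End MapBase.

Lemma specialize_sections (k : 'I_5 -> int) (u v p q r s : algC) :
  section_comb_eq0 k (fun i => section_map i) ->
  u ^+ 6 + v ^+ 6 + p ^+ 6 + q ^+ 6 = 2%:R * (r ^+ 6 + s ^+ 6) /\ u * v = p * q ->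
  elliptic (E_pqrs p q r s) ->
  ec_comb (E_pqrs p q r s) k (fun i => nth Infinity (sections u v p q r s) i) = Infinity.
Proof.
move=> k0 uvC ell; pose t : 6.-tuple algC := [tuple u; v; p; q; r; s].
rewrite -[RHS](k0 t uvC ell (fun i => section_map_defined i t)).
by apply: eq_bigr => i _; rewrite section_at_map.
Qed.

(** A combination that vanishes on all smooth fibres vanishes at the base point, where it is the
    image of a rational combination; field morphisms send only Infinity to Infinity. *)
Lemma rank_over_C5 : rank_over_C_ge 5.
Proof.
exists (fun i => section_map i); split.
  move=> i; split.
    by move=> h h0 t tC; apply: h0 => //; apply: section_map_defined.
  move=> t [e uv] W X Y Z.
  have two0 : (2%:R : algC) != 0 by rewrite pnatr_eq0.
  have Z1 : Z = 1 by apply: section_map_Z.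
  have := sections_on_curve two0 i uv e; rewrite -section_at_map ?ltn_ord //.
  by rewrite /section_at -/Z Z1 oner_eq0 !divr1 /= !expr1n !mulr1.
move=> k k0; have [ell indep] := base_sections_independent.
apply: indep.
have := specialize_sections k0 (base_on_C algC).
rewrite -[E_pqrs _ _ _ _]/(base_curve algC) -(map_base_curve ratr).
move=> /(_ (map_elliptic _ ell)) comb.
have : map_point (ratr : rat -> algC)
    (ec_comb (base_curve rat) k (fun i => base_section rat i)) = Infinity.
  rewrite map_ec_comb -[RHS]comb; apply: eq_bigr => i _.
  by rewrite map_base_section.
by case: ec_comb.
Qed.

(** * Density of the smooth fibres *)

Lemma rmorph_mmap (n : nat) (R S T : comNzRingType) (g : {rmorphism S -> T})
    (f : R -> S) (h : 'I_n -> S) (p : {mpoly R[n]}) :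
  g (mmap f h p) = mmap (g \o f) (g \o h) p.
Proof.
rewrite /mmap rmorph_sum; apply: eq_bigr => m _; rewrite rmorphM; congr (_ * _).
by rewrite /mmap1 rmorph_prod; apply: eq_bigr => i _; rewrite rmorphXn.
Qed.

Lemma eq_mmap (n : nat) (R S : comNzRingType) (f f' : R -> S) (h h' : 'I_n -> S) p :
  f =1 f' -> h =1 h' -> mmap f h p = mmap f' h' p.
Proof.
move=> ff hh; apply: eq_bigr => m _; rewrite ff; congr (_ * _).
by apply: eq_bigr => i _; rewrite hh.
Qed.

Lemma mpeval_mmap h t : mpeval h t = mmap ratr (tnth t) h.
Proof.
rewrite /mpeval -[map_mpoly ratr h]/(mmap _ _ h) rmorph_mmap.
by apply: eq_mmap => [c|i] /=; rewrite ?mevalC ?mevalXU.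
Qed.

Lemma poly_eq0_everywhere (F : numFieldType) (p : {poly F}) : (forall x, p.[x] = 0) -> p = 0.
Proof.
move=> p0; apply: (@roots_geq_poly_eq0 _ p [seq i%:R | i <- iota 0 (size p)]).
- by apply/allP => x _; rewrite /root p0.
- by rewrite map_inj_uniq ?iota_uniq //; apply: (mulrIn (oner_neq0 F)).
by rewrite size_map size_iota.
Qed.

(** A nonzero c has n distinct n-th roots, too many for a nonzero polynomial of degree below n. *)
Lemma poly_eq0_roots_of_power (p : {poly algC}) (n : nat) (c : algC) :
  (0 < n)%N -> c != 0 -> (size p <= n)%N ->
  (forall s, s ^+ n = c -> p.[s] = 0) -> p = 0.
Proof.
move=> n0 c0 sp p0; have [z zn] := C_prim_root_exists n0.
pose s0 := n.-root c; have s0n : s0 ^+ n = c by apply: rootCK.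
have s00 : s0 != 0 by apply: contra_neq c0 => e; rewrite -s0n e expr0n gtn_eqF.
apply: (@roots_geq_poly_eq0 _ p [seq s0 * z ^+ i | i <- iota 0 n]).
- apply/allP => x /mapP [i _ ->]; rewrite /root p0 //.
  by rewrite exprMn s0n exprAC (prim_expr_order zn) expr1n mulr1.
- rewrite map_inj_in_uniq ?iota_uniq // => i j; rewrite !mem_iota /= => iI jI.
  move/(mulfI s00)/eqP; rewrite (eq_prim_root_expr zn) !modn_small //.
  by move/eqP.
by rewrite size_map size_iota.
Qed.

(* The discriminant is a constant times the product of the eight forms
   p^3 +- q^3 +- r^3 +- s^3; on C it depends on s only through s^6. *)
Definition bad_poly (W p q : algC) : {poly algC} :=
  let B c := (((p ^+ 3 + c * q ^+ 3) ^+ 2 - W) ^+ 2)%:P - (4%:R * W) *: 'X^6 + 4%:R *: 'X^12 in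
  B 1 * B (-1).

Lemma bad_polyE W p q r s : s ^+ 6 = W - r ^+ 6 ->
  disc (E_pqrs p q r s) = - 27%:R * (bad_poly W p q).[r].
Proof.
move=> sW; set E := E_pqrs p q r s.
have -> : disc E = - (64%:R * a4 E ^+ 3 + 27%:R * (4%:R * a6 E) ^+ 2).
  by rewrite /disc; ring.
rewrite a6_E_pqrs ?pnatr_eq0 // [a4 E]/(curveA p q r s) /curveA /curveB.
have -> : (- 3%:R * (p * q * r * s) ^+ 2) ^+ 3 =
    - 27%:R * (p ^+ 6 * q ^+ 6 * r ^+ 6 * s ^+ 6) by ring.
by rewrite sW /bad_poly hornerM !(hornerD, hornerN, hornerZ, hornerXn, hornerC); ring.
Qed.

Lemma bad_poly_neq0 W p q : bad_poly W p q != 0.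
Proof.
have B0 c : (((p ^+ 3 + c * q ^+ 3) ^+ 2 - W) ^+ 2)%:P - (4%:R * W) *: 'X^6
    + 4%:R *: 'X^12 != 0 :> {poly algC}.
  (* The coefficient of X^12 is 4. *)
  apply/eqP => /(congr1 (fun f : {poly algC} => f`_12)).
  rewrite coef0 coefD coefB coefC !coefZ !coefXn /= mulr0 subr0 add0r mulr1.
  by apply/eqP; rewrite pnatr_eq0.
by rewrite /bad_poly mulf_neq0.
Qed.

(** With u, v, p, q fixed, C becomes s^6 = W - r^6. The remainder of h modulo this equation has
    degree at most 5 in s and, for each r outside a finite set, vanishes at six values of s. So the
    remainder is 0 and h vanishes on the whole slice. *)
Lemma elliptic_dense : elliptic_over_C.
Proof.
move=> h h0 t [e uv].
pose W := (t`_0 ^+ 6 + t`_1 ^+ 6 + t`_2 ^+ 6 + t`_3 ^+ 6) / 2%:R.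
have two0 : (2%:R : algC) != 0 by rewrite pnatr_eq0.
pose tup r s : 6.-tuple algC := [tuple t`_0; t`_1; t`_2; t`_3; r; s].
have tupC r s : s ^+ 6 = W - r ^+ 6 -> on_C (tup r s).
  move=> sW; split; rewrite /= ?uv //.
  have -> : r ^+ 6 + s ^+ 6 = W by rewrite sW addrC subrK.
  by rewrite mulrC divfK.
(* The outer variable is s, the inner one r. *)
pose P i : {poly {poly algC}} :=
  nth 0 [:: (t`_0)%:P%:P; (t`_1)%:P%:P; (t`_2)%:P%:P; (t`_3)%:P%:P; 'X%:P; 'X] i.
pose H : {poly {poly algC}} := mmap (fun c => (ratr c)%:P%:P) (fun i : 'I_6 => P i) h.
have HE r s : H.[s%:P].[r] = mpeval h (tup r s).
  rewrite mpeval_mmap -[LHS]/(horner_eval r (horner_eval s%:P H)) !rmorph_mmap.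
  apply: eq_mmap => [c|i] /=; first by rewrite /horner_eval !hornerE.
  rewrite (tnth_nth 0) /P /horner_eval.
  by case: i => -[|[|[|[|[|[|//]]]]]] lti /=; rewrite !hornerE.
pose M : {poly {poly algC}} := 'X^6 - (W%:P - 'X^6)%:P.
have Mmonic : M \is monic by apply: monicXnsubC.
have ME r s : s ^+ 6 = W - r ^+ 6 -> M.[s%:P].[r] = 0.
  by move=> sW; rewrite /M !hornerE sW subrr.
pose Q := Pdiv.CommonRing.rdivp H M; pose Rm := Pdiv.CommonRing.rmodp H M.
have HQ : H = Q * M + Rm by apply: Pdiv.RingMonic.rdivp_eq.
have RE r s : s ^+ 6 = W - r ^+ 6 -> Rm.[s%:P].[r] = mpeval h (tup r s).
  by move=> sW; rewrite -HE HQ hornerD hornerM hornerD hornerM ME // mulr0 add0r.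
have sR : (size Rm <= 6)%N.
  have := Pdiv.CommonRing.ltn_rmodp H M.
  by rewrite monic_neq0 // /M size_XnsubC.
(* The roots of G are the values of r to avoid: those with singular fibres and those with s = 0,
   where the six sixth roots coincide. *)
pose G := bad_poly W t`_2 t`_3 * (W%:P - 'X^6).
have G0 : G != 0.
  rewrite mulf_neq0 ?bad_poly_neq0 // -oppr_eq0 opprB.
  by rewrite -size_poly_eq0 size_XnsubC.
have R0 : Rm = 0.
  apply/polyP => j; rewrite coef0; apply/eqP.
  have : Rm`_j * G = 0.
    apply: poly_eq0_everywhere => r; rewrite hornerM.
    have [->|Gr] := eqVneq G.[r] 0; first by rewrite mulr0.
    move: Gr; rewrite /G hornerM mulf_eq0 negb_or => /andP [Br].
    rewrite hornerD hornerN hornerXn hornerC => Wr.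
    have Rr : map_poly (horner_eval r) Rm = 0.
      apply: (@poly_eq0_roots_of_power _ 6 (W - r ^+ 6)) => //.
        exact: leq_trans (size_poly _ _) sR.
      move=> s sW; have -> : s = horner_eval r s%:P by rewrite /horner_eval hornerC.
      rewrite horner_map /= /horner_eval RE //; apply: h0; first exact: tupC.
      rewrite /elliptic -[E_uvpqrs _]/(E_pqrs t`_2 t`_3 r s) (bad_polyE _ _ sW).
      by rewrite mulf_neq0 ?oppr_eq0 ?pnatr_eq0.
    have := congr1 (fun f : {poly algC} => f`_j) Rr.
    by rewrite coef_map coef0 /= /horner_eval => ->; rewrite mul0r.
  by move/eqP; rewrite mulf_eq0 (negPf G0) orbF.
have st : t`_5 ^+ 6 = W - t`_4 ^+ 6.
  by rewrite /W e mulrC mulKf // addrC addKr.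
have -> : t = tup t`_4 t`_5.
  apply: eq_from_tnth => i; rewrite !(tnth_nth 0).
  by case: i => -[|[|[|[|[|[|//]]]]]] lti.
by rewrite -RE // R0 !horner0.
Qed.

(** * Specialisation of the generic curve *)

Section NonVanishing.
Variable R : idomainType.

Definition uni_var (n : nat) (i : 'I_n.+1) : {poly {mpoly R[n]}} :=
  if unlift ord_max i is Some j then ('X_j)%:P else 'X.

(** The polynomial seen as univariate in its last variable. *)
Definition uni (n : nat) (h : {mpoly R[n.+1]}) : {poly {mpoly R[n]}} :=
  mmap (polyC \o @mpolyC n R) (@uni_var n) h.

(** Widening the coefficients and substituting the last variable recovers h. *)
Lemma uni_eq0 n (h : {mpoly R[n.+1]}) : uni h = 0 -> h = 0.
Proof.
move=> h0.
have : (map_poly (mwiden (n := n) (R := R)) (uni h)).['X_ord_max] = h.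
  rewrite -[LHS]/(horner_eval _ (map_poly _ _)) !rmorph_mmap -[RHS]comp_mpoly_id.
  apply: eq_mmap => [c|i] /=.
    by rewrite map_polyC /= /horner_eval hornerC mwidenC.
  rewrite tnth_mktuple /uni_var /horner_eval.
  case: unliftP => [j ->|->]; last by rewrite map_polyX hornerX.
  rewrite map_polyC /= hornerC mwidenX mnmwiden1; congr 'X_[U_(_)]; apply: val_inj => /=.
  by rewrite /bump leqNgt ltn_ord.
by rewrite h0 rmorph0 horner0.
Qed.

Lemma uni_eval n (h : {mpoly R[n.+1]}) (t : 'I_n.+1 -> R) :
  h.@[t] = (map_poly (meval (fun j => t (lift ord_max j))) (uni h)).[t ord_max].
Proof.
rewrite -[RHS]/(horner_eval _ (map_poly _ _)) !rmorph_mmap.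
apply: eq_mmap => [c|i] /=; first by rewrite map_polyC /= /horner_eval hornerC mevalC.
rewrite /uni_var /horner_eval.
case: unliftP => [j ->|->]; last by rewrite map_polyX hornerX.
by rewrite map_polyC /= hornerC mevalXU.
Qed.

(** By induction, the leading coefficient in the last variable is nonzero somewhere on the smaller
    grid; then only finitely many values of the last variable are roots. *)
Lemma meval_neq0 n (h : {mpoly R[n]}) (e : 'I_n -> nat -> R) :
  (forall i, injective (e i)) -> h != 0 ->
  exists m : 'I_n -> nat, h.@[fun i => e i (m i)] != 0.
Proof.
elim: n h e => [|n IH] h e einj h0.
  exists (fun _ => 0%N); move: h0; rewrite (nvar0_mpolyC h) mevalC.
  by apply: contra_neq => ->; rewrite mpolyC0.
have u0 : uni h != 0 by apply: contra_neq h0; apply: uni_eq0.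
have [||m] := IH (lead_coef (uni h)) (fun j => e (lift ord_max j)).
- by move=> i; apply: einj.
- by rewrite lead_coef_eq0.
set v := fun i => _ => lm.
pose p := map_poly (meval v) (uni h).
have p0 : p != 0.
  apply: contra_neq lm => /(congr1 (fun q : {poly R} => q`_(size (uni h)).-1)).
  by rewrite coef_map coef0.
have [k pk] : exists k, p.[e ord_max k] != 0.
  have [/hasP [x /mapP [k _ ->] pk]|/hasPn pr] :=
    boolP (has (fun x => p.[x] != 0) [seq e ord_max k | k <- iota 0 (size p)]).
    by exists k.
  case/eqP: p0; apply: (@roots_geq_poly_eq0 _ p [seq e ord_max k | k <- iota 0 (size p)]).
  - by apply/allP => x /pr; rewrite negbK.
  - by rewrite map_inj_uniq ?iota_uniq.
  by rewrite size_map size_iota.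
exists (fun i => if unlift ord_max i is Some j then m j else k).
rewrite uni_eval unlift_none; congr (_ != 0): pk; congr (_.[_]).
by apply: eq_map_poly => q; apply: meval_eq => j; rewrite liftK.
Qed.

End NonVanishing.

(** * Specialisation of fractions and of the group law *)

Section Specialization.
Variables (R : idomainType) (F : fieldType).
Local Notation K := {fraction R}.
Implicit Types (ev : {rmorphism R -> F}) (z w : K) (c d : F) (P Q : point K).

(** The fraction z is regular at the point [ev] and takes the value c there. *)
Definition spec ev z c : Prop := exists a b,
  [/\ ev b != 0, z * tofrac b = tofrac a & c * ev b = ev a].

Lemma spec_base ev a : spec ev (tofrac a) (ev a).
Proof. by exists a, 1; rewrite !rmorph1 !mulr1 oner_neq0. Qed.

Lemma specD ev z w c d : spec ev z c -> spec ev w d -> spec ev (z + w) (c + d).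
Proof.
move=> [a [b [b0 zb cb]]] [a' [b' [b0' wb db]]]; exists (a * b' + a' * b), (b * b').
split; first by rewrite rmorphM mulf_neq0.
  by rewrite tofracD !tofracM -zb -wb; ring.
by rewrite rmorphD !rmorphM -cb -db; ring.
Qed.

Lemma specM ev z w c d : spec ev z c -> spec ev w d -> spec ev (z * w) (c * d).
Proof.
move=> [a [b [b0 zb cb]]] [a' [b' [b0' wb db]]]; exists (a * a'), (b * b').
split; first by rewrite rmorphM mulf_neq0.
  by rewrite !tofracM -zb -wb; ring.
by rewrite !rmorphM -cb -db; ring.
Qed.

Lemma specN ev z c : spec ev z c -> spec ev (- z) (- c).
Proof. by case=> a [b [b0 zb cb]]; exists (- a), b; rewrite tofracN rmorphN -zb -cb !mulNr. Qed.

Lemma specB ev z w c d : spec ev z c -> spec ev w d -> spec ev (z - w) (c - d).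
Proof. by move=> zc /specN; apply: specD. Qed.

Lemma spec_nat ev n : spec ev n%:R n%:R.
Proof. by have := spec_base ev n%:R; rewrite !rmorph_nat. Qed.

Lemma specX ev z c n : spec ev z c -> spec ev (z ^+ n) (c ^+ n).
Proof.
move=> zc; elim: n => [|n IH]; first by rewrite !expr0; apply: (spec_nat ev 1).
by rewrite !exprS; apply: specM.
Qed.

Lemma spec0 ev c : spec ev 0 c -> c = 0.
Proof.
case=> a [b [b0]]; rewrite mul0r => /esym /eqP; rewrite tofrac_eq0 => /eqP ->.
by rewrite rmorph0 => /eqP; rewrite mulf_eq0 (negPf b0) orbF => /eqP.
Qed.

Lemma fraction_ratio z : exists2 ab : R * R, ab.2 != 0 & z * tofrac ab.2 = tofrac ab.1.
Proof.
elim/quotW: z => x; exists (\n_x, \d_x); first exact: denom_ratioP.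
rewrite -[LHS]/(FracField.mul _ _) !piE; apply/eqmodP => /=.
by rewrite FracField.equivfE /FracField.mulf !numden_Ratio ?mulf_neq0 ?oner_neq0 ?denom_ratioP //
  !mulr1 mulrC.
Qed.

(** Zero tests commute with specialisation wherever the numerator of a nonzero z does not vanish. *)
Lemma spec_neq0 z : exists2 h : R, h != 0 &
  forall ev c, ev h != 0 -> spec ev z c -> (c == 0) = (z == 0).
Proof.
have [->|z0] := eqVneq z 0.
  by exists 1 => [|ev c _ /spec0 ->]; rewrite ?oner_neq0 ?eqxx.
have [[a b] /= b0 zE] := fraction_ratio z.
have tb0 : tofrac b != 0 :> K by rewrite tofrac_eq0.
exists a; first by rewrite -(@tofrac_eq0 R) -zE mulf_neq0.
move=> ev c a0 [a' [b' [b0' zb cb]]]; apply/negbTE/eqP => c0; move: zb cb.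
rewrite c0 mul0r => zb /esym a'0.
have /eqP : a * b' = a' * b.
  by apply/eqP; rewrite -(@tofrac_eq R) !tofracM -zb -zE mulrAC.
move=> /eqP /(congr1 ev); rewrite !rmorphM a'0 mul0r => /eqP.
by rewrite mulf_eq0 (negPf a0) (negPf b0').
Qed.

Lemma specV ev z c : (c == 0) = (z == 0) -> spec ev z c -> spec ev z^-1 c^-1.
Proof.
have [->|z0] := eqVneq z 0; first by move/eqP->; rewrite !invr0.
move=> /negbT c0 [a [b [b0 zb cb]]]; exists b, a.
by split; rewrite -?zb -?cb ?mulf_neq0 ?mulKf.
Qed.

Definition spec_curve ev (W : weierstrass K) (W' : weierstrass F) : Prop :=
  spec ev (a4 W) (a4 W') /\ spec ev (a6 W) (a6 W').

Definition spec_point ev P (Q : point F) : Prop :=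
  match P, Q with
  | Infinity, Infinity => True
  | Affine x y, Affine x' y' => spec ev x x' /\ spec ev y y'
  | _, _ => False
  end.

Lemma spec_line ev l x y z l' x' y' (z' : F) :
  spec ev l l' -> spec ev x x' -> spec ev y y' -> spec ev z z' ->
  spec_point ev (ec_line l x y z) (ec_line l' x' y' z').
Proof.
move=> hl hx hy hz; have h3 := specB (specB (specX 2 hl) hx) hz.
by split=> //; apply: specB => //; apply: specM => //; apply: specB.
Qed.

Lemma spec_opp ev P (P' : point F) : spec_point ev P P' -> spec_point ev (ec_opp P) (ec_opp P').
Proof. by case: P P' => [|x y] [|x' y'] //= [hx hy]; split=> //; apply: specN. Qed.

(** The case analysis and the divisions of the group law depend on x1 - x2, y1 + y2 and 2 y1; h
    makes the zero tests for these three agree before and after specialisation. *)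
Lemma spec_add W P Q : exists2 h : R, h != 0 & forall ev W' (P' Q' : point F),
  ev h != 0 -> spec_curve ev W W' -> spec_point ev P P' -> spec_point ev Q Q' ->
  spec_point ev (ec_add W P Q) (ec_add W' P' Q').
Proof.
case: P Q => [|x1 y1] Q.
  by exists 1; rewrite ?oner_neq0 // => ev W' [|//] Q'.
case: Q => [|x2 y2].
  by exists 1; rewrite ?oner_neq0 // => ev W' [|x y] [|//].
have [h1 h10 H1] := spec_neq0 (x1 - x2).
have [h2 h20 H2] := spec_neq0 (y1 + y2).
have [h3 h30 H3] := spec_neq0 (2%:R * y1).
exists (h1 * h2 * h3); first by rewrite !mulf_neq0.
move=> ev W' [//|x1' y1'] [//|x2' y2']; rewrite !rmorphM !mulf_eq0 !negb_or -andbA.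
case/and3P=> e1 e2 e3 [A4 A6] [sx1 sy1] [sx2 sy2] /=.
have x12 : (x1' == x2') = (x1 == x2).
  by rewrite -(subr_eq0 x1') -(subr_eq0 x1); apply: H1 (specB sx1 sx2).
rewrite x12; case: (eqVneq x1 x2) => [ex|nx] /=.
  rewrite -(addr_eq0 y1') -(addr_eq0 y1) (H2 _ _ e2 (specD sy1 sy2)).
  case: ifP => // ne; apply: spec_line => //; apply: specM.
    by apply: specD => //; apply: specM; [apply: spec_nat | apply: specX].
  have s2y := specM (spec_nat ev 2) sy1.
  exact: specV (H3 _ _ e3 s2y) s2y.
apply: spec_line => //; apply: specM; first exact: specB.
apply: specV; last exact: specB.
by rewrite !subr_eq0 ![_ == x1]eq_sym -x12 eq_sym.
Qed.

Lemma spec_iter W P n : exists2 h : R, h != 0 & forall ev W' (P' : point F),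
  ev h != 0 -> spec_curve ev W W' -> spec_point ev P P' ->
  spec_point ev (iter n (ec_add W P) Infinity) (iter n (ec_add W' P') Infinity).
Proof.
elim: n => [|n [h h0 IH]]; first by exists 1; rewrite ?oner_neq0.
have [h' h0' H] := spec_add W P (iter n (ec_add W P) Infinity).
exists (h * h'); first exact: mulf_neq0.
move=> ev W' P'; rewrite rmorphM mulf_eq0 negb_or => /andP [e e'] sW sP /=.
by apply: H => //; apply: IH.
Qed.

Lemma spec_mulz W P (k : int) : exists2 h : R, h != 0 & forall ev W' (P' : point F),
  ev h != 0 -> spec_curve ev W W' -> spec_point ev P P' ->
  spec_point ev (ec_mulz W k P) (ec_mulz W' k P').
Proof.
case: k => n; last first.
  have [h h0 H] := spec_iter W P n.+1.
  by exists h => // ev W' P' e sW sP; apply: spec_opp; apply: H.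
by have [h h0 H] := spec_iter W P n; exists h => // ev W' P'; apply: H.
Qed.

Lemma spec_comb W n (k : 'I_n -> int) (P : 'I_n -> point K) : exists2 h : R, h != 0 &
  forall ev W' (P' : 'I_n -> point F), ev h != 0 -> spec_curve ev W W' ->
  (forall i, spec_point ev (P i) (P' i)) -> spec_point ev (ec_comb W k P) (ec_comb W' k P').
Proof.
rewrite /ec_comb; elim: (index_enum _) => [|i s [h h0 IH]].
  by exists 1; rewrite ?oner_neq0 // => ev W' P'; rewrite !big_nil.
have [h1 h10 H1] := spec_mulz W (P i) (k i).
have [h2 h20 H2] := spec_add W (ec_mulz W (k i) (P i))
  (\big[ec_add W/Infinity]_(j <- s) ec_mulz W (k j) (P j)).
exists (h * h1 * h2); first by rewrite !mulf_neq0.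
move=> ev W' P'; rewrite !rmorphM !mulf_eq0 !negb_or -andbA => /and3P [e e1 e2] sW sP.
by rewrite !big_cons; apply: H2 => //; [apply: H1 | apply: IH].
Qed.

Ltac spec_tac :=
  repeat lazymatch goal with
  | |- spec _ (_ + _) _ => apply: specD
  | |- spec _ (- _) _ => apply: specN
  | |- spec _ (_ * _) _ => apply: specM
  | |- spec _ (_ ^+ _) _ => apply: specX
  | |- spec _ (_ %:R) _ => exact: spec_nat
  | |- spec _ _ _ => eassumption
  end.

Lemma spec_neq0_inv ev z c : spec ev z c -> c != 0 -> z != 0.
Proof. by move=> zc; apply: contra_neq => z0; rewrite z0 in zc; apply: spec0 zc. Qed.

Lemma spec_natV ev n : (n%:R : F) != 0 -> spec ev n%:R^-1 n%:R^-1.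
Proof.
move=> n0; apply: specV; last exact: spec_nat.
by rewrite (negPf n0) (negPf (spec_neq0_inv (spec_nat ev n) n0)).
Qed.

Lemma spec_elliptic ev W (W' : weierstrass F) :
  spec_curve ev W W' -> elliptic W' -> elliptic W.
Proof. by case=> ? ?; apply: spec_neq0_inv; rewrite /disc; spec_tac. Qed.

Lemma spec_E_pqrs ev p q r s (p' q' r' s' : F) : (4%:R : F) != 0 ->
  spec ev p p' -> spec ev q q' -> spec ev r r' -> spec ev s s' ->
  spec_curve ev (E_pqrs p q r s) (E_pqrs p' q' r' s').
Proof. by move=> /(spec_natV ev) *; split; rewrite /=; spec_tac. Qed.

Lemma spec_sections ev u v p q r s (u' v' p' q' r' s' : F) i : (2%:R : F) != 0 ->
  spec ev u u' -> spec ev v v' ->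
  spec ev p p' -> spec ev q q' -> spec ev r r' -> spec ev s s' ->
  spec_point ev (nth Infinity (sections u v p q r s) i)
    (nth Infinity (sections u' v' p' q' r' s') i).
Proof.
move=> /(spec_natV ev) *.
by case: i => [|[|[|[|[|i]]]]] /=; rewrite ?nth_nil //; split; spec_tac.
Qed.

End Specialization.

(** The values p, q, r, s of the base point, shifted by multiples of 31 * 37 * 61: modulo these
    primes every grid point has the residues of the base point. *)
Definition grid_point (m : 'I_4 -> nat) (i : 'I_4) : int :=
  (nth 0 [:: 75 * 11; 68 * 91; 77 * 85; 468] i + 31 * 37 * 61 * m i)%N.

(** The zeros fill the places of u, v and k; the first three abscissas are expressed by p, q, r,
    s. *)
Definition grid_tuple (m : 'I_4 -> nat) : seq int :=
  [:: 0; 0; grid_point m (inord 0); grid_point m (inord 1); grid_point m (inord 2);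
      grid_point m (inord 3); 0].

Definition grid_residues (l : nat) : seq nat :=
  [:: 0; 0; 75 * 11 %% l; 68 * 91 %% l; 77 * 85 %% l; 468 %% l; 0]%N.

Definition grid_chars : seq (nat * nat) := [:: (31, 29); (61, 28); (61, 42)]%N.

Lemma grid_check : independence_check 3 grid_residues 37 grid_chars.
Proof. by vm_compute. Qed.

Lemma grid_has_residues m l : l \in [:: 31; 37; 61]%N ->
  has_residues grid_residues l (grid_tuple m).
Proof.
move=> ml; have l1 : (1 < l)%N by move: ml; rewrite !inE => /or3P [] /eqP ->.
have l0 : 31%:R * 37%:R * 61%:R = 0 :> 'Z_l.
  have := pchar_Zp l1; move: ml; rewrite !inE => /or3P [] /eqP -> ->;
    by rewrite ?mul0r ?mulr0 ?mul0r.
have gE i : (grid_point m i)%:~R =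
    (nth 0%N [:: 75 * 11; 68 * 91; 77 * 85; 468]%N i)%:R :> 'Z_l.
  by rewrite -pmulrn natrD !natrM l0 mul0r addr0.
by move=> i; case: i => [|[|[|[|[|[|[|//]]]]]]] _; rewrite [_`_ _]/= ?gE ?inordK //= Zp_nat_mod.
Qed.

Lemma sections_xcoords (R : comNzRingType) (u v p q r s k : R) i : (i < 4)%N ->
  (sections_x u v p q r s)`_i = (xcoords u v p q r s k)`_i.
Proof. by case: i => [|[|[|[|//]]]]. Qed.

Lemma generic_rank3 : elliptic E_generic /\ rank_ge E_generic 3.
Proof.
pose c m i : rat := (grid_point m i)%:~R.
pose ev m : {rmorphism {mpoly rat[4]} -> rat} := meval (c m).
have evX m i : spec (ev m) (Qvar i) (c m i).
  by have := spec_base (ev m) 'X_i; rewrite [ev m _]mevalXU.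
have two0 : (2%:R : rat) != 0 by [].
have evE m : spec_curve (ev m) E_generic (E_int (grid_tuple m)).
  by apply: spec_E_pqrs => //; apply: evX.
have ev0 m : spec (ev m) 0 0 by apply: (spec_nat _ 0).
pose P (i : 'I_3) := nth Infinity (sections 0 0 (Qvar (inord 0)) (Qvar (inord 1))
  (Qvar (inord 2)) (Qvar (inord 3))) i.
pose P' m (i : 'I_3) := nth Infinity (sections 0 0 (c m (inord 0)) (c m (inord 1))
  (c m (inord 2)) (c m (inord 3))) i.
have evP m i : spec_point (ev m) (P i) (P' m i) by apply: spec_sections.
have main m : elliptic (E_int (grid_tuple m)) /\ forall k : 'I_3 -> int,
    ec_comb (E_int (grid_tuple m)) k (P' m) = Infinity -> forall i, k i = 0.
  have := @independence_of_check 3 _ _ _ (grid_tuple m) (P' m) isT grid_check; apply.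
  - exact: grid_has_residues.
  - have /allP pr : all (fun c => c.1 \in [:: 31; 37; 61]%N) grid_chars by [].
    by move=> x /pr; apply: grid_has_residues.
  - by move=> i; apply: sections_on_curve3.
  move=> i; rewrite /P' nth_sections; last exact: leq_trans (ltn_ord i) _.
  eexists; congr Affine.
  rewrite (sections_xcoords _ _ _ _ _ _ 0); last exact: leq_trans (ltn_ord i) _.
  rewrite -(nth_map 0 0 intr); last exact: leq_trans (ltn_ord i) _.
  by rewrite xcoords_morph.
have two0' : (2%:R : Qpqrs) != 0.
  exact: spec_neq0_inv (spec_nat (ev (fun _ => 0%N)) 2) two0.
split; first exact: spec_elliptic (evE (fun _ => 0%N)) (proj1 (main _)).
exists P; split=> [i|k kP]; first exact: sections_on_curve3.
have [h h0 H] := spec_comb rat E_generic k P.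
have einj i : injective (fun n =>
    (nth 0 [:: 75 * 11; 68 * 91; 77 * 85; 468] i + 31 * 37 * 61 * n)%N%:R : rat).
  move=> a b /eqP; rewrite eqr_nat => /eqP /addnI /eqP.
  by rewrite eqn_pmul2l // => /eqP.
(* At a grid point where h does not vanish, the generic relation specialises to one between
   independent rational points. *)
have [m hm] := meval_neq0 einj h0.
apply: (proj2 (main m)).
have := H (ev m) _ _ hm (evE m) (evP m).
by rewrite kP; case: ec_comb.
Qed.

(** * A curve of positive rank on C *)

Section States.
Variable R : comNzRingType.
Implicit Type st : R * R * R * R.

Definition state_ok st : Prop :=
  let: (W, Z, V, e) := st in
  Z ^+ 2 = W ^+ 2 + 16%:R * e ^+ 2 /\ V ^+ 2 = W ^+ 2 + 100%:R * e ^+ 2.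

(* Doubling on the intersection of quadrics of [state_ok], an elliptic curve. *)
Definition double st : R * R * R * R :=
  let: (W, Z, V, e) := st in
  (W ^+ 4 - (40%:R * e ^+ 2) ^+ 2,
   W ^+ 4 + 32%:R * W ^+ 2 * e ^+ 2 + (40%:R * e ^+ 2) ^+ 2,
   W ^+ 4 + 200%:R * W ^+ 2 * e ^+ 2 + (40%:R * e ^+ 2) ^+ 2,
   2%:R * W * Z * V * e).

Lemma double_ok st : state_ok st -> state_ok (double st).
Proof.
case: st => [[[W Z] V] e] [HZ HV]; split; first by ring: HZ HV.
by ring: HZ HV.
Qed.

Definition coords st : seq R :=
  let: (W, Z, V, e) := st in
  [:: W * V * (W * Z + 4%:R * e * V); 10%:R * e * Z * (W * Z - 4%:R * e * V);
      W * V * (W * Z - 4%:R * e * V); 10%:R * e * Z * (W * Z + 4%:R * e * V);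
      Z * V * (W ^+ 2 + 40%:R * e ^+ 2); 6%:R * e * W * (W ^+ 2 - 40%:R * e ^+ 2);
      2%:R * e * Z * W * V * (W ^+ 4 - (40%:R * e ^+ 2) ^+ 2)].

Lemma coords_uv st : (coords st)`_0 * (coords st)`_1 = (coords st)`_2 * (coords st)`_3.
Proof. by case: st => [[[W Z] V] e] /=; ring. Qed.

Lemma coords_pq st : state_ok st ->
  (coords st)`_2 * (coords st)`_3 = 5%:R * (coords st)`_6.
Proof. by case: st => [[[W Z] V] e] [HZ HV] /=; ring: HZ HV. Qed.

Lemma coords_rs st : (coords st)`_4 * (coords st)`_5 = 3%:R * (coords st)`_6.
Proof. by case: st => [[[W Z] V] e] /=; ring. Qed.

Lemma coords_sum2 st : state_ok st ->
  (coords st)`_2 ^+ 2 + (coords st)`_3 ^+ 2 =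
  (coords st)`_4 ^+ 2 + (coords st)`_5 ^+ 2 - 4%:R * (coords st)`_6.
Proof. by case: st => [[[W Z] V] e] [HZ HV] /=; ring: HZ HV. Qed.

Lemma coords_sum6 st : state_ok st ->
  (coords st)`_0 ^+ 6 + (coords st)`_1 ^+ 6 + (coords st)`_2 ^+ 6 + (coords st)`_3 ^+ 6 =
  2%:R * ((coords st)`_4 ^+ 6 + (coords st)`_5 ^+ 6).
Proof. by case: st => [[[W Z] V] e] [HZ HV] /=; ring: HZ HV. Qed.

End States.

Definition map_state (R S : Type) (f : R -> S) (st : R * R * R * R) : S * S * S * S :=
  let: (W, Z, V, e) := st in (f W, f Z, f V, f e).

Section MapState.
Variables (R S : comNzRingType) (f : {rmorphism R -> S}).

Lemma map_state_ok st : state_ok st -> state_ok (map_state f st).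
Proof.
case: st => [[[W Z] V] e] [HZ HV].
by split; rewrite -rmorphXn ?HZ ?HV; ring.
Qed.

Lemma map_double st : map_state f (double st) = double (map_state f st).
Proof. by case: st => [[[W Z] V] e]; congr (_, _, _, _) => /=; ring. Qed.

Lemma map_iter_double n st :
  map_state f (iter n (@double R) st) = iter n (@double S) (map_state f st).
Proof. by elim: n => //= n IH; rewrite map_double IH. Qed.

Lemma map_coords st i : f (coords st)`_i = (coords (map_state f st))`_i.
Proof.
case: st => [[[W Z] V] e].
by case: i => [|[|[|[|[|[|[|i]]]]]]] /=; rewrite ?nth_nil ?rmorph0 //; ring.
Qed.

End MapState.

(** Three doublings bring the starting point into the periodic part of the orbit modulo each prime
    used. *)
Definition state0 (R : comNzRingType) : R * R * R * R :=
  iter 3 (@double R) (15%:R, 17%:R, 25%:R, 2%:R).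

Definition nth_state (R : comNzRingType) (n : nat) : R * R * R * R :=
  iter (6 * n) (@double R) (state0 R).

Lemma map_nth_state (R S : comNzRingType) (f : {rmorphism R -> S}) n :
  map_state f (nth_state R n) = nth_state S n.
Proof. by rewrite !map_iter_double; congr (iter _ _ (iter _ _ _)); rewrite /= !rmorph_nat. Qed.

Lemma iter_double_ok (R : comNzRingType) n (st : R * R * R * R) :
  state_ok st -> state_ok (iter n (@double R) st).
Proof. by move=> ok; elim: n => //= n; apply: double_ok. Qed.

Lemma nth_state_ok (R : comNzRingType) n : state_ok (nth_state R n).
Proof. by apply: iter_double_ok; apply: iter_double_ok; split; ring. Qed.

Definition state_residues (l : nat) : seq nat :=
  (if l == 41 then [:: 2; 34; 24; 37; 35; 26; 30]
  else if l == 53 then [:: 50; 6; 38; 33; 31; 40; 7]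
  else if l == 61 then [:: 54; 4; 53; 34; 38; 49; 31]
  else if l == 113 then [:: 94; 110; 47; 107; 69; 85; 34]
  else if l == 131 then [:: 12; 99; 95; 98; 53; 9; 28]
  else [::])%N.

Definition state_chars : seq (nat * nat) :=
  [:: (41, 36); (61, 17); (61, 49); (113, 39); (131, 6)]%N.

Lemma state_check : independence_check 5 state_residues 53 state_chars.
Proof. by vm_compute. Qed.

Lemma state_periodic : all (fun l =>
    (iter 6 (@double 'Z_l) (state0 'Z_l) == state0 'Z_l)
    && (coords (state0 'Z_l) == [seq i%:R | i <- state_residues l]))
  [:: 41; 53; 61; 113; 131]%N.
Proof. by vm_compute. Qed.

Lemma state_has_residues n l : l \in [:: 41; 53; 61; 113; 131]%N ->
  has_residues state_residues l (coords (nth_state int n)).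
Proof.
move=> ll; have /andP [/eqP per /eqP res] := allP state_periodic l ll => i i7.
rewrite (map_coords intr) map_nth_state.
have -> : nth_state 'Z_l n = state0 'Z_l.
  by rewrite /nth_state mulnC; elim: n => // n IH; rewrite mulSn addnC iterD per.
have s7 : size (state_residues l) = 7.
  by rewrite -(size_map (fun i => i%:R : 'Z_l)) -res; case: (state0 _) => [[[W Z] V] e].
by rewrite res (nth_map 0%N) // s7.
Qed.

Section Members.
Variable st : int * int * int * int.
Hypothesis ok : state_ok st.

Definition coord (i : nat) : rat := ((coords st)`_i)%:~R.

Definition state_point (i : nat) : point rat :=
  if (i < 4)%N then
    nth Infinity (sections (coord 0) (coord 1) (coord 2) (coord 3) (coord 4) (coord 5)) i
  else
    let k := coord 6 in let d := coord 4 ^+ 2 - coord 5 ^+ 2 in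
    Affine (55%:R * k ^+ 2 + 12%:R * d * k)
      (k * (12%:R * d ^+ 2 + 288%:R * d * k + 700%:R * k ^+ 2) / 2%:R).

Let okq : state_ok (map_state (intr : int -> rat) st) := map_state_ok _ ok.

Lemma state_point_on_curve (i : 'I_5) : on_curve (E_int (coords st)) (state_point i).
Proof.
have two0 : (2%:R : rat) != 0 by [].
rewrite /state_point; case: ifP => _.
  apply: sections_on_curve => //; rewrite /coord !(map_coords intr).
    exact: coords_uv.
  exact: coords_sum6.
apply: extra_on_curve => //; rewrite /coord !(map_coords intr).
- exact: coords_pq.
- exact: coords_rs.
exact: coords_sum2.
Qed.

Lemma state_pointE (i : 'I_5) : exists y, state_point i = Affine
  ((xcoords (coords st)`_0 (coords st)`_1 (coords st)`_2 (coords st)`_3 (coords st)`_4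
      (coords st)`_5 (coords st)`_6)`_i)%:~R y.
Proof.
rewrite -(nth_map 0 0 intr) // xcoords_morph /state_point; case: ifP => i4.
  by rewrite nth_sections ?ltn_ord // (sections_xcoords _ _ _ _ _ _ (coord 6)) //; eexists.
have -> : nat_of_ord i = 4.
  by apply/eqP; rewrite eqn_leq -ltnS ltn_ord leqNgt i4.
by eexists.
Qed.

Definition state_tuple : 6.-tuple rat :=
  [tuple coord 0; coord 1; coord 2; coord 3; coord 4; coord 5].

Lemma state_tuple_on_C : on_C state_tuple.
Proof.
by split; rewrite /= /coord !(map_coords intr); [apply: coords_sum6 | apply: coords_uv].
Qed.

Lemma E_state_tuple : E_uvpqrs state_tuple = E_int (coords st).
Proof. by []. Qed.

End Members.

Lemma state_curve_rank n :
  elliptic (E_int (coords (nth_state int n))) /\ rank_ge (E_int (coords (nth_state int n))) 5.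
Proof.
have ok := nth_state_ok int n; move: (state_has_residues n); move: (nth_state int n) ok.
move=> st ok res; have on := state_point_on_curve ok.
have := @independence_of_check 5 _ _ _ (coords st) (fun i => state_point st i) isT state_check.
case=> //; first exact: res.
- have /allP pr : all (fun c => c.1 \in [:: 41; 53; 61; 113; 131]%N) state_chars by [].
  by move=> x /pr; apply: res.
- by move=> i; apply: state_pointE.
by move=> ell indep; split; last exists (fun i => state_point st i).
Qed.

(** * Pairwise non-isomorphism by 2-adic valuations *)

Definition is_odd (a : int) : Prop := a%:~R = 1 :> 'Z_2.

Lemma is_oddM a b : is_odd a -> is_odd b -> is_odd (a * b).
Proof. by rewrite /is_odd rmorphM /= => -> ->; rewrite mulr1. Qed.

Lemma is_oddX a n : is_odd a -> is_odd (a ^+ n).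
Proof. by rewrite /is_odd rmorphXn /= => ->; rewrite expr1n. Qed.

Lemma pow2_odd_inj i j (a b : int) : is_odd a -> is_odd b ->
  2%:R ^+ i * a = 2%:R ^+ j * b -> i = j.
Proof.
wlog ij : i j a b / (i <= j)%N => [wl|] oa ob e.
  by case/orP: (leq_total i j) => ij; [|apply: esym]; [apply: (wl i j a b) | apply: (wl j i b a)].
move: e; rewrite -(subnKC ij) exprD -mulrA => /(mulfI (expf_neq0 _ (isT : (2%:R : int) != 0))).
case: (j - i)%N => [|m]; first by rewrite addn0.
move/(congr1 (intr : int -> 'Z_2)); rewrite oa rmorphM rmorphXn /= ob exprS mulr1.
have -> : 2%:R%:~R = 0 :> 'Z_2 by apply: val_inj.
by rewrite mul0r => /eqP.
Qed.

Section Coefficients.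
Variable R : comNzRingType.
Implicit Types W Z V e Y d : R.

(* With e = Y d, this is (r^2 - p^2) / (8 Y). *)
Definition diff_rp W Z V Y d : R :=
  V ^+ 2 * d * (10%:R * Z * Y * d + V * W)
    * (Z * W ^+ 2 + 20%:R * Z * (Y * d) ^+ 2 - 2%:R * Y * d * V * W).

(** With e = Y d these are p, q / (2 Y), r and s / (2 Y). *)
Definition reduced_coords W Z V Y d : seq R :=
  let e := Y * d in
  [:: W * V * (W * Z - 4%:R * e * V); 5%:R * d * Z * (W * Z + 4%:R * e * V);
      Z * V * (W ^+ 2 + 40%:R * e ^+ 2); 3%:R * d * W * (W ^+ 2 - 40%:R * e ^+ 2)].

Definition reduced_A W Z V Y d : R :=
  let c := reduced_coords W Z V Y d in - 3%:R * (c`_0 * c`_1 * c`_2 * c`_3) ^+ 2.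

Definition reduced_B W Z V Y d : R :=
  let c := reduced_coords W Z V Y d in let M := diff_rp W Z V Y d in
  (8%:R * Y ^+ 5 * (c`_1 ^+ 6 - c`_3 ^+ 6)
   - M * (c`_2 ^+ 4 + c`_2 ^+ 2 * c`_0 ^+ 2 + c`_0 ^+ 4)) ^+ 2
  - 4%:R * Y ^+ 4 * (c`_0 ^+ 6 * c`_1 ^+ 6 + c`_2 ^+ 6 * c`_3 ^+ 6).

Lemma curveA_reduced W Z V Y d : let c := coords (W, Z, V, Y * d) in
  curveA c`_2 c`_3 c`_4 c`_5 = 16%:R * Y ^+ 4 * reduced_A W Z V Y d.
Proof. by rewrite /curveA /reduced_A /=; ring. Qed.

(** Factoring r^6 - p^6 through r^2 - p^2 extracts 8 Y from p^6 + q^6 - r^6 - s^6. *)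
Lemma curveB_diff (p q r s Y M : R) : r ^+ 2 = p ^+ 2 + 8%:R * Y * M ->
  curveB p (2%:R * Y * q) r (2%:R * Y * s) = 64%:R * Y ^+ 2 *
    ((8%:R * Y ^+ 5 * (q ^+ 6 - s ^+ 6) - M * (r ^+ 4 + r ^+ 2 * p ^+ 2 + p ^+ 4)) ^+ 2
     - 4%:R * Y ^+ 4 * (p ^+ 6 * q ^+ 6 + r ^+ 6 * s ^+ 6)).
Proof. by move=> rE; rewrite /curveB; ring: rE. Qed.

Lemma curveB_reduced W Z V Y d : state_ok (W, Z, V, Y * d) ->
  let c := coords (W, Z, V, Y * d) in
  curveB c`_2 c`_3 c`_4 c`_5 = 64%:R * Y ^+ 2 * reduced_B W Z V Y d.
Proof.
case=> HZ HV c; rewrite /reduced_B -curveB_diff; last first.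
  by rewrite /diff_rp /=; ring: HZ HV.
by congr curveB; rewrite /=; ring.
Qed.

End Coefficients.

Lemma reduced_A_morph (R S : comNzRingType) (f : {rmorphism R -> S}) W Z V Y d :
  f (reduced_A W Z V Y d) = reduced_A (f W) (f Z) (f V) (f Y) (f d).
Proof. by rewrite /reduced_A /=; ring. Qed.

Lemma reduced_B_morph (R S : comNzRingType) (f : {rmorphism R -> S}) W Z V Y d :
  f (reduced_B W Z V Y d) = reduced_B (f W) (f Z) (f V) (f Y) (f d).
Proof. by rewrite /reduced_B /diff_rp /=; ring. Qed.

(** For Y = 2^i this makes the valuations of a4 and 4 a6 equal to 4 i + 4 and 2 i + 6. Oddness is
    computed in 'Z_2 for each of the two residues of Y. *)
Lemma reduced_odd W Z V Y d : is_odd W -> is_odd Z -> is_odd V -> is_odd d ->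
  is_odd (reduced_A W Z V Y d) /\ is_odd (reduced_B W Z V Y d).
Proof.
rewrite /is_odd => oW oZ oV od.
rewrite reduced_A_morph reduced_B_morph /= oW oZ oV od.
by case: (Y%:~R) => [[|[|//]]] Y2; split; apply: val_inj; vm_compute.
Qed.

Definition two_adic (st : int * int * int * int) (i : nat) : Prop :=
  let: (W, Z, V, e) := st in
  [/\ is_odd W, is_odd Z, is_odd V & exists2 d, is_odd d & e = 2%:R ^+ i * d].

Lemma two_adic_double st i : two_adic st i -> two_adic (double st) i.+1.
Proof.
case: st => [[[W Z] V] e] [oW oZ oV [d od ->]].
have o4 (c : int) : is_odd (W ^+ 4 + 2%:R * c).
  rewrite /is_odd rmorphD rmorphM /= (is_oddX 4 oW).
  have -> : 2%:R%:~R = 0 :> 'Z_2 by apply: val_inj.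
  by rewrite mul0r addr0.
split; last by exists (W * Z * V * d); [do !apply: is_oddM | rewrite exprS; ring].
- set x := _ - _; have -> : x = W ^+ 4 + 2%:R * (- 800%:R * (2%:R ^+ i * d) ^+ 4).
    by rewrite /x; ring.
  exact: o4.
- set x := _ + _; have -> : x = W ^+ 4 + 2%:R *
    (16%:R * W ^+ 2 * (2%:R ^+ i * d) ^+ 2 + 800%:R * (2%:R ^+ i * d) ^+ 4).
    by rewrite /x; ring.
  exact: o4.
set x := _ + _; have -> : x = W ^+ 4 + 2%:R *
  (100%:R * W ^+ 2 * (2%:R ^+ i * d) ^+ 2 + 800%:R * (2%:R ^+ i * d) ^+ 4).
  by rewrite /x; ring.
exact: o4.
Qed.

Lemma two_adic_iter m st i : two_adic st i -> two_adic (iter m (@double int) st) (m + i).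
Proof. by move=> ok; elim: m => //= m; rewrite addSn; apply: two_adic_double. Qed.

Lemma two_adic_nth_state n : two_adic (nth_state int n) (6 * n + 4).
Proof.
(* The starting e = 2 has valuation 1, and the three doublings of [state0] raise it to 4. *)
apply: two_adic_iter; apply: (two_adic_iter 3 (i := 1)); split; try exact: val_inj.
by exists 1; [exact: val_inj | rewrite mulr1].
Qed.

(** The quotient a4^3 / a6^2 is unchanged by scaling with l^4 and l^6; it is compared after
    cross-multiplication. *)
Lemma isomorphic_int (W W' : weierstrass rat) (A B A' B' : int) :
  a4 W = A%:~R -> 4%:R * a6 W = B%:~R -> a4 W' = A'%:~R -> 4%:R * a6 W' = B'%:~R ->
  ec_isomorphic W W' -> A ^+ 3 * B' ^+ 2 = A' ^+ 3 * B ^+ 2.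
Proof.
move=> HA HB HA' HB' [l _ [e4 e6]]; apply: (@intr_inj rat).
transitivity (a4 W ^+ 3 * (4%:R * a6 W') ^+ 2); first by rewrite HA HB'; ring.
transitivity (a4 W' ^+ 3 * (4%:R * a6 W) ^+ 2); last by rewrite HA' HB; ring.
by rewrite e4 e6; move: (a4 W') (a6 W') => x y; ring.
Qed.

Lemma two_adic_isomorphic st st' i j :
  state_ok st -> state_ok st' -> two_adic st i -> two_adic st' j ->
  ec_isomorphic (E_int (coords st)) (E_int (coords st')) -> i = j.
Proof.
have HA s : a4 (E_int (coords s)) =
    (curveA (coords s)`_2 (coords s)`_3 (coords s)`_4 (coords s)`_5)%:~R.
  by rewrite curveA_morph.
have HB s : 4%:R * a6 (E_int (coords s)) =
    (curveB (coords s)`_2 (coords s)`_3 (coords s)`_4 (coords s)`_5)%:~R.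
  by rewrite curveB_morph a6_E_pqrs.
move=> ok ok' ad ad' /(isomorphic_int (HA _) (HB _) (HA _) (HB _)).
case: st st' ok ok' ad ad' => [[[W Z] V] e] [[[W' Z'] V'] e'] ok ok'.
move=> [oW oZ oV [d od eE]] [oW' oZ' oV' [d' od' eE']]; subst e e'.
have [oA oB] := reduced_odd (2%:R ^+ i) oW oZ oV od.
have [oA' oB'] := reduced_odd (2%:R ^+ j) oW' oZ' oV' od'.
rewrite !curveA_reduced !curveB_reduced //.
set A := reduced_A _ _ _ _ _ in oA *; set A' := reduced_A _ _ _ _ _ in oA' *.
set B := reduced_B _ _ _ _ _ in oB *; set B' := reduced_B _ _ _ _ _ in oB' *.
have pw m k : 2%:R ^+ (m * k) = (2%:R ^+ k) ^+ m :> int by rewrite mulnC exprM.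
have c0 : (16%:R ^+ 3 * 64%:R ^+ 2 : int) != 0 by rewrite !(mulf_neq0, expf_neq0).
(* A^3 contributes Y^12 and B^2 contributes Y^4, so comparing exponents gives 12 i + 4 j = 12 j + 4
   i. *)
move=> e; have key : 2%:R ^+ (12 * i + 4 * j) * (A ^+ 3 * B' ^+ 2) =
    2%:R ^+ (12 * j + 4 * i) * (A' ^+ 3 * B ^+ 2) :> int.
  apply: (mulfI c0); rewrite (exprD _ (12 * i)) (exprD _ (12 * j)) !pw.
  move: e; clearbody A A' B B'; move: (2%:R ^+ i) (2%:R ^+ j) => X Y e.
  have -> : 16%:R ^+ 3 * 64%:R ^+ 2 * (X ^+ 12 * Y ^+ 4 * (A ^+ 3 * B' ^+ 2)) =
    (16%:R * X ^+ 4 * A) ^+ 3 * (64%:R * Y ^+ 2 * B') ^+ 2 by ring.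
  by rewrite e; ring.
have := pow2_odd_inj (is_oddM (is_oddX 3 oA) (is_oddX 2 oB'))
  (is_oddM (is_oddX 3 oA') (is_oddX 2 oB)) key.
by clear; lia.
Qed.

Theorem theorem1p1 :
  (elliptic E_generic /\ rank_ge E_generic 3) /\
  (elliptic_over_C /\ rank_over_C_ge 5) /\
  (exists S : nat -> 6.-tuple rat,
     (forall n : nat,
        on_C (S n) /\ elliptic (E_uvpqrs (S n)) /\
        rank_ge (E_uvpqrs (S n)) 5) /\
     (forall m n : nat,
        ec_isomorphic (E_uvpqrs (S m)) (E_uvpqrs (S n)) -> m = n)).
Proof.
split; first exact: generic_rank3.
split; first by split; [exact: elliptic_dense | exact: rank_over_C5].
exists (fun n => state_tuple (nth_state int n)); split=> [n|m n].
  split; first by apply: state_tuple_on_C; apply: nth_state_ok.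
  by rewrite E_state_tuple; apply: state_curve_rank.
rewrite !E_state_tuple => /(two_adic_isomorphic (nth_state_ok _ _) (nth_state_ok _ _)
  (two_adic_nth_state m) (two_adic_nth_state n)).
by lia.
Qed.
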